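(* Assume first that the weight perturbation is uniformly controlled: $$0<\inf_{i\in I}\beta_i\le\sup_{i\in I}\beta_i<\infty.$$ Assume next that there exist $J\in\mathbb N$ and $\rho_{\mathrm{tail}}\in(0,1/9)$ such that the following conditions hold. (1) For each low mode $j=1,\dots,J-1$ there exist constants $c_j>0$, $C_j<\infty$, $M_j<\infty$ such that, for all $i\in I$ and all $t\in[0,T]$, $$c_j\le\sigma_{ij}+\kappa_t\lambda_j\le C_j,\qquad c_j\le\sigma_{ij}+\Delta\sigma_{ij}+\kappa_t\lambda_j\le C_j,\qquad |\Delta m_{ij}|\le M_j,$$ and, for every $s\in\{-8,0,1,\dots,8\}$, $$\sigma_{ij}+\kappa_t\lambda_j+(1-s)\Delta\sigma_{ij}\ge c_j.$$ (2) For every $i\in I$, every $j\ge J$ and every $t\in[0,T]$, $$|\Delta\sigma_{ij}|\le\rho_{\mathrm{tail}}(\sigma_{ij}+\kappa_t\lambda_j),\qquad |\Delta m_{ij}|\le\rho_{\mathrm{tail}}\sqrt{\sigma_{ij}+\kappa_t\lambda_j}.$$ (3) $$\sup_{i\in I}\sup_{t\in[0,T]}\sup_{d\ge1}\sum_{j=J}^d\left(\frac{(\Delta\sigma_{ij})^2}{(\sigma_{ij}+\kappa_t\lambda_j)^2}+\frac{(\Delta m_{ij})^2}{\sigma_{ij}+\kappa_t\lambda_j}\right)<\infty.$$ Assume, in addition, that $$\sup_{t\in[0,T]}\sup_{d\ge1}\sum_{i,\ell\in I}w_iw_\ell\left(\sum_{j=1}^d\gamma_j\left[\frac{\big((\sigma_{\ell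 j}-\sigma_{ij})+(\Delta\sigma_{\ell j}-\Delta\sigma_{ij})\big)^2(\sigma_{ij}+\kappa_t\lambda_j)}{(\sigma_{ij}+\Delta\sigma_{ij}+\kappa_t\lambda_j)^2(\sigma_{\ell j}+\Delta\sigma_{\ell j}+\kappa_t\lambda_j)^2}+\left(\frac{\Delta m_{ij}}{\sigma_{ij}+\Delta\sigma_{ij}+\kappa_t\lambda_j}-\frac{m_{\ell j}-m_{ij}+\Delta m_{\ell j}}{\sigma_{\ell j}+\Delta\sigma_{\ell j}+\kappa_t\lambda_j}\right)^2\right]\right)^2<\infty.$$ Then $$\sup_{t\in[0,T]}\sup_{d\ge1}\mathbb E_{X\sim\rho_t^d}\Big[\big\|(\Gamma^d)^{1/2}I_2(X,t)\big\|^2\Big]<\infty.$$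
   Context: Setting. $T>0$ is fixed and $\kappa_t:=(T-t)/T$ for $t\in[0,T]$. $I$ is a finite or countably infinite index set; $w_i>0$, $\sum_{i\in I}w_i=1$. For $i\in I$, $j\ge1$: $m_{ij}\in\mathbb R$, $\sigma_{ij}>0$ with $\sum_jm_{ij}^2<\infty$, $\sum_j\sigma_{ij}<\infty$ for every $i$. $\lambda_j>0$ with $\sum_j\lambda_j<\infty$; $\gamma_j>0$. Perturbed parameters: $\widetilde m_{ij}=m_{ij}+\Delta m_{ij}$; perturbed variances $\sigma_{ij}+\Delta\sigma_{ij}>0$; $\widetilde w_i=w_i+\Delta w_i>0$ with $\sum_{i\in I}\widetilde w_i=1$; $\beta_i:=\widetilde w_i/w_i$. None of these sequences depends on $d$. For $d\ge1$: $\Gamma^d=\mathrm{Diag}(\gamma_1,\dots,\gamma_d)$, $m_i^d=(m_{i1},\dots,m_{id})$, $\widetilde m_i^d=(\widetilde m_{i1},\dots,\widetilde m_{id})$, $$\Sigma_{i,t}^d:=\mathrm{Diag}(\sigma_{ij}+\kappa_t\lambda_j)_{j=1}^d,\qquad \widetilde\Sigma_{i,t}^d:=\mathrm{Diag}(\sigma_{ij}+\Delta\sigma_{ij}+\kappa_t\lambda_j)_{j=1}^d.$$ $\varphi_{i,t}^d$ and $\widetilde\varphi_{i,t}^d$ are the densities of $\mathcal N(m_i^d,\Sigma_{i,t}^d)$ and $\mathcal N(\widetilde m_i^d,\widetilde\Sigma_{i,t}^d)$, and $$\rho_t^d=\sum_{i\in I}w_i\varphi_{i,t}^d,\qquad \widetilde\rho_t^{\,d}=\sum_{i\in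 I}\widetilde w_i\widetilde\varphi_{i,t}^d,\qquad p_{i,t}^d=\frac{w_i\varphi_{i,t}^d}{\rho_t^d},\qquad \widetilde p_{i,t}^d=\frac{\widetilde w_i\widetilde\varphi_{i,t}^d}{\widetilde\rho_t^{\,d}},$$ $$\widetilde S_{i,t}^d(x):=-(\widetilde\Sigma_{i,t}^d)^{-1}(x-\widetilde m_i^d),\qquad I_2(x,t):=\sum_{i\in I}\big(p_{i,t}^d(x)-\widetilde p_{i,t}^d(x)\big)\widetilde S_{i,t}^d(x).$$ *)

(* Defs.v *)
From HB Require Import structures.
From mathcomp Require Import all_boot all_order all_algebra.
From mathcomp Require Import all_classical all_reals all_analysis.

Set Implicit Arguments.
Unset Strict Implicit.
Unset Printing Implicit Defensive.

Import Order.TTheory GRing.Theory Num.Theory.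
Import numFieldNormedType.Exports.

Local Open Scope classical_set_scope.
Local Open Scope ring_scope.

Reserved Notation "\esup_ ( x 'in' A ) F"
  (at level 41, F at level 41, x at level 50,
   format "'[' \esup_ ( x  'in'  A ) '/  '  F ']'").
Notation "\esup_ ( x 'in' A ) F" := (ereal_sup [set F%E | x in A]) : ereal_scope.

(* The library has the product sigma-algebra on d.-tuple R but no Lebesgue
   measure on it. It is built here by induction on d: Lebesgue measure on R^0 is
   the unit mass, and Lebesgue measure on R^(d+1) is the image of the product
   measure on R x R^d under (x, v) |-> x :: v. *)
Section measure_tuple_cons.
Context dsp (X : measurableType dsp) (R : realType) (d : nat).

Definition tuple_cons (p : X * d.-tuple X) : d.+1.-tuple X :=
  [tuple of p.1 :: p.2].

Lemma measurable_tuple_cons : measurable_fun [set: _] tuple_cons.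
Proof. exact: (measurable_cons measurable_fst measurable_snd). Qed.

Context (m1 : {sigma_finite_measure set X -> \bar R}).
Context (mu : {sigma_finite_measure set (d.-tuple X) -> \bar R}).

Definition measure_tuple_cons : set (d.+1.-tuple X) -> \bar R :=
  pushforward (m1 \x mu)%E tuple_cons.

Let cons0 : (measure_tuple_cons set0 = 0)%E.
Proof. by rewrite /measure_tuple_cons /pushforward preimage_set0 measure0. Qed.

Let cons_ge0 A : (0 <= measure_tuple_cons A)%E.
Proof. exact: (measure_ge0 (m1 \x mu)%E). Qed.

Let mpre (A : set (d.+1.-tuple X)) : measurable A ->
  measurable (tuple_cons @^-1` A).
Proof.
by move=> mA; rewrite -[X in measurable X]setTI; apply: measurable_tuple_cons.
Qed.

Let cons_sigma_additive : semi_sigma_additive measure_tuple_cons.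
Proof.
move=> F mF tF mUF; rewrite /measure_tuple_cons /pushforward preimage_bigcup.
apply: measure_semi_sigma_additive.
- by move=> n; exact: mpre.
- apply/trivIsetP => /= i j _ _ ij; rewrite -preimage_setI.
  by move/trivIsetP : tF => /(_ _ _ _ _ ij) ->//; rewrite preimage_set0.
- by rewrite -preimage_bigcup; exact: mpre.
Qed.

HB.instance Definition _ := isMeasure.Build _ _ _ measure_tuple_cons
  cons0 cons_ge0 cons_sigma_additive.

Let cons_sigma_finite : sigma_finite setT measure_tuple_cons.
Proof.
have /sigma_finiteP[F [TF ndF Foo]] := sigma_finiteT m1.
have /sigma_finiteP[G [TG ndG Goo]] := sigma_finiteT mu.
pose h (v : d.+1.-tuple X) : X * d.-tuple X := (thead v, [tuple of behead v]).
have mh : measurable_fun [set: _] h.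
  apply/measurable_fun_pairP; split => /=.
    exact: measurable_tnth.
  exact: measurable_behead.
have hK : cancel tuple_cons h.
  by case=> x v; congr pair; apply/val_inj.
exists (fun n => h @^-1` (F n `*` G n)).
  apply/esym; rewrite -subTset => v _.
  have [n _ Fn] : (\bigcup_n F n) (h v).1 by rewrite -TF.
  have [k _ Gk] : (\bigcup_n G n) (h v).2 by rewrite -TG.
  exists (maxn n k) => //; split.
  - by move: Fn; exact/subsetPset/ndF/leq_maxl.
  - by move: Gk; exact/subsetPset/ndG/leq_maxr.
move=> n; have [mF Fn] := Foo n; have [mG Gn] := Goo n; split.
  by rewrite -[X in measurable X]setTI; apply: mh => //; exact: measurableX.
rewrite /measure_tuple_cons /pushforward.
rewrite (_ : _ @^-1` _ = F n `*` G n); last first.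
  by rewrite -comp_preimage (_ : h \o _ = idfun) ?preimage_id//; apply/funext.
by rewrite product_measure1E// lte_mul_pinfty// ge0_fin_numE.
Qed.

HB.instance Definition _ := Measure_isSigmaFinite.Build _ _ _
  measure_tuple_cons cons_sigma_finite.

End measure_tuple_cons.

Fixpoint lebesgue_tuple (R : realType) (d : nat) :
    {sigma_finite_measure set (d.-tuple (measurableTypeR R)) -> \bar R} :=
  match d with
  | 0 => \d_([tuple] : 0.-tuple (measurableTypeR R))
  | d'.+1 => measure_tuple_cons lebesgue_measure (lebesgue_tuple R d')
  end.

Definition gaussian_pdf (R : realType) (d : nat)
    (m : 'cV[R]_d) (S : 'M[R]_d) (x : 'cV[R]_d) : R :=
  expR (- (((x - m)^T *m invmx S *m (x - m)) 0 0 / 2))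
  / Num.sqrt ((2 * pi) ^+ d * \det S).

(* Modes are numbered from 0: index j : nat stands for mode j + 1. The
   definitions of this section take the weights w, means m and variances s as
   arguments, so that each serves for both the reference mixture and the
   perturbed one. *)
Section mixture.
Context (R : realType) (I : countType).
Implicit Types (T t : R) (w : I -> R) (m s : I -> nat -> R).
Implicit Types (lambda gamma : nat -> R) (d : nat) (i : I).

Definition kappa T t : R := (T - t) / T.

Definition modevar T lambda s i t (j : nat) : R := s i j + kappa T t * lambda j.

Definition mean_vec m d i : 'cV[R]_d := \col_(j < d) m i j.

Definition cov_mx T lambda s d i t : 'M[R]_d :=
  diag_mx (\row_(j < d) modevar T lambda s i t j).

Definition comp_pdf T lambda m s d i t (x : 'cV[R]_d) : R :=
  gaussian_pdf (mean_vec m d i) (cov_mx T lambda s d i t) x.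

Definition mixture_pdf T lambda w m s d t (x : 'cV[R]_d) : \bar R :=
  \esum_(i in [set: I]) (w i * comp_pdf T lambda m s i t x)%:E.

(* For infinite I, mixture_pdf may take the value +oo, but only on a
   Lebesgue-null set, since its integral is the sum of the weights. *)
Definition posterior T lambda w m s d i t (x : 'cV[R]_d) : R :=
  w i * comp_pdf T lambda m s i t x / fine (mixture_pdf T lambda w m s t x).

Definition score T lambda m s d i t (x : 'cV[R]_d) : 'cV[R]_d :=
  - (invmx (cov_mx T lambda s d i t) *m (x - mean_vec m d i)).

(* Unordered sum of a signed family, positive part minus negative part. It is
   the usual sum if the family is absolutely summable, and is infinite (hence
   never silently replaced by a finite value) otherwise. *)
Definition signed_esum (f : I -> R) : \bar R :=
  (\esum_(i in [set: I]) (Num.max (f i) 0)%:E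
   - \esum_(i in [set: I]) (Num.max (- f i) 0)%:E)%E.

Definition I2 T lambda w m s w' m' s' d t (x : 'cV[R]_d) (j : 'I_d) : \bar R :=
  signed_esum (fun i =>
    (posterior T lambda w m s i t x - posterior T lambda w' m' s' i t x)
    * score T lambda m' s' i t x j 0).

(* Squared Euclidean norm of Gamma^(1/2) v, Gamma = Diag(gamma); the coordinates
   of v are extended reals because those of I2 are. *)
Definition weighted_norm2 gamma d (v : 'I_d -> \bar R) : \bar R :=
  (\sum_(j < d) ((Num.sqrt (gamma j))%:E * v j) ^+ 2)%E.

(* Expectation of f X, where X has density mixture_pdf. *)
Definition mixture_expectation T lambda w m s d t
    (f : 'cV[R]_d -> \bar R) : \bar R :=
  (\int[lebesgue_tuple R d]_x
     (f (\col_j tnth x j) * mixture_pdf T lambda w m s t (\col_j tnth x j)))%E.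

End mixture.

(* Main.v *)
Require Import Defs.
From HB Require Import structures.
From mathcomp Require Import all_boot all_order all_algebra.
From mathcomp Require Import all_classical all_reals all_analysis.
From mathcomp Require Import measurable_realfun ring lra.

Set Implicit Arguments.
Unset Strict Implicit.
Unset Printing Implicit Defensive.

Import Order.TTheory GRing.Theory Num.Theory.
Import numFieldNormedType.Exports.

Local Open Scope classical_set_scope.
Local Open Scope ring_scope.

(** Write [p i], [q i] for the posteriors of the reference and the perturbed
    mixture, [S i] for the perturbed scores, [phi i], [phi' i] for the component
    densities, [beta i] for the ratio of the weights and
    [u i = beta i * phi' i / phi i]. Then [q i = p i * u i / U] with
    [U = sum p i * u i], and since both posteriors sum to [1], for every index [l]
    [[
      I2 = sum_i p i * (1 - u i / U) * (S i - S l).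
    ]]
    By Jensen's inequality, with [D i l] the squared weighted norm of
    [S i - S l], the squared norm of [I2] is at most
    [sum_i p i * (1 - u i / U)^2 * D i l], and Young's inequality separates the
    ratio from the scores. Young's inequality again, together with Jensen's
    inequality [U^-8 <= sum p i * u i^-8], leaves only [u i^8] and [u i^-8]:
    the squared norm is at most [sum_i p i * cost (u i) (D i l)]
    ([reweighting_bound]).

    Multiplying by the reference mixture density turns [p i] into [w i * phi i]
    and removes all denominators ([mixture_reweighting_bound]); averaging over
    the anchor [l] against the prior weights [w l] produces the pair sum
    of the moment hypothesis. It remains to integrate two kinds of terms.

    The product of [phi i] with the power [s = 8] or [s = -8] of [phi' i / phi i]
    is a Gaussian density times an explicit mass. Per mode, the logarithm of that
    mass is quadratic in the perturbation, because the first-order terms cancel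
    ([tilt_log_mass_le]). Hence the masses multiply to a quantity bounded
    uniformly in [i], [t] and [d]: the tail modes by the summability hypothesis,
    the finitely many low modes by constants ([tilt_log_mass_low]).

    The product of [phi i] with [(D i l)^2] needs Gaussian fourth moments. Since
    [D i l] is a weighted sum of squares of affine functions of single
    coordinates, Cauchy--Schwarz reduces its square to fourth powers in one
    coordinate ([upper_integral_sqr_sum]), and a fourth power times a Gaussian
    density is dominated by Gaussian densities ([normal_pdf_moment4]). So
    every integral that occurs is the total mass of a product of
    one-dimensional Gaussian densities ([integral_normal_prod]). *)

(** * Sums over countable types *)

Lemma maxB_id {R : realType} (x : R) : Num.max x 0 - Num.max (- x) 0 = x.
Proof.
have [x0|x0] := orP (le_total 0 x).
  by rewrite max_l// max_r ?subr0// oppr_le0.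
by rewrite max_r// max_l ?sub0r ?opprK// oppr_ge0.
Qed.

Lemma maxD_abs {R : realType} (x : R) : Num.max x 0 + Num.max (- x) 0 = `|x|.
Proof.
have [x0|x0] := orP (le_total 0 x).
  by rewrite max_l// max_r ?addr0 ?ger0_norm// oppr_le0.
by rewrite max_r// max_l ?add0r ?ler0_norm// oppr_ge0.
Qed.

Section countable_sums.
Local Open Scope ereal_scope.
Context {R : realType} {I : countType}.
Implicit Types (a b : I -> \bar R) (f g p : I -> R).

(** Through this series over the codes of the elements of [I], monotone
    convergence applies to sums over [I]. *)
Lemma esum_nneseries a : (forall i, 0 <= a i) ->
  \esum_(i in [set: I]) a i = \sum_(n <oo) oapp a 0 (pickle_inv n).
Proof.
move=> a0; rewrite nneseries_esumT; last by move=> n; case: pickle_inv.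
have inj : {in [set: I] &, injective (@pickle I)}.
  by move=> i j _ _ /(pcan_inj (@pickleK I)).
transitivity (\esum_(n in pickle @` [set: I])
    oapp a 0 (pickle_inv n : option I)).
  by rewrite (@esum_image R I nat setT pickle _ inj); apply: eq_esum => i _; rewrite pickleK_inv.
rewrite esum_mkcond; apply: eq_esum => n _; case: ifPn => // nI.
case E : (pickle_inv n) => [i|]//=; move/negP: nI; case.
by rewrite inE; exists i => //; have := @pickle_invK I n; rewrite /ocancel E.
Qed.

Lemma ge0_esumZl (k : R) a : (0 <= k)%R -> (forall i, 0 <= a i) ->
  \esum_(i in [set: I]) (k%:E * a i) = k%:E * \esum_(i in [set: I]) a i.
Proof.
move=> k0 a0; rewrite !esum_nneseries//; last by move=> i; rewrite mule_ge0.
rewrite -nneseriesZl//; last by move=> n _; case: pickle_inv.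
by apply: eq_eseriesr => n _; case: pickle_inv => //=; rewrite mule0.
Qed.

Lemma esum_ge_term a i : (forall k, 0 <= a k) -> a i <= \esum_(k in [set: I]) a k.
Proof.
move=> a0; rewrite (esumID [set i])//= setTI esum_set1// leeDl//.
exact: esum_ge0.
Qed.

Lemma ge0_integral_esum d (X : measurableType d)
    (mu : {measure set X -> \bar R}) (F : I -> X -> \bar R) :
  (forall i, measurable_fun [set: X] (F i)) -> (forall i x, 0 <= F i x) ->
  \int[mu]_x (\esum_(i in [set: I]) F i x) =
  \esum_(i in [set: I]) (\int[mu]_x F i x).
Proof.
move=> mF F0.
under eq_integral do rewrite esum_nneseries//.
rewrite integral_nneseries//=; last 2 first.
  by move=> n; case: pickle_inv.
  by move=> n x _; case: pickle_inv => //= i; exact: F0.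
rewrite esum_nneseries; last by move=> i; apply: integral_ge0 => x _; exact: F0.
by apply: eq_eseriesr => n _; case: pickle_inv => //=; rewrite integral0.
Qed.

Lemma ge0_measurable_esum d (X : measurableType d) (F : I -> X -> \bar R) :
  (forall i, measurable_fun [set: X] (F i)) -> (forall i x, 0 <= F i x) ->
  measurable_fun [set: X] (fun x => \esum_(i in [set: I]) F i x).
Proof.
move=> mF F0.
under eq_fun do rewrite esum_nneseries//.
apply: ge0_emeasurable_sum => [n x _ _|n _]; first by case: pickle_inv => //= i; exact: F0.
by case: pickle_inv => //=.
Qed.

Lemma fin_num_le (x y : \bar R) : 0 <= x -> x <= y -> y < +oo -> x \is a fin_num.
Proof. by move=> x0 xy yoo; rewrite ge0_fin_numE// (le_lt_trans xy). Qed.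

(** [f] and [g] exceed the positive and negative parts of [f - g] by the same
    amount. *)
Lemma signed_esumB f g : (forall i, 0 <= f i)%R -> (forall i, 0 <= g i)%R ->
  \esum_(i in [set: I]) (f i)%:E < +oo -> \esum_(i in [set: I]) (g i)%:E < +oo ->
  signed_esum (fun i => f i - g i)%R =
    \esum_(i in [set: I]) (f i)%:E - \esum_(i in [set: I]) (g i)%:E.
Proof.
move=> f0 g0 foo goo.
have sf : summable [set: I] (EFin \o f).
  by rewrite /summable; under eq_esum do rewrite /= ger0_norm//.
have sg : summable [set: I] (EFin \o g).
  by rewrite /summable; under eq_esum do rewrite /= ger0_norm//.
have := @esumB R I [set: I] _ _ sf sg.
move=> <- //=; [|by move=> i _; rewrite lee_fin..].
by rewrite /signed_esum; congr (_ - _); apply: eq_esum => i _;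
  rewrite ?funeposE ?funenegE /= -?EFinB -?EFinN EFin_max.
Qed.

(** The constant [c] contributes [c * (1 - 1) = 0]. Its positive and negative
    parts are distributed over both sides, so that all sums stay nonnegative. *)
Lemma signed_esum_center (p q s : I -> R) (c : R) :
  (forall i, 0 <= p i)%R -> (forall i, 0 <= q i)%R ->
  \esum_(i in [set: I]) (p i)%:E = 1 -> \esum_(i in [set: I]) (q i)%:E = 1 ->
  \esum_(i in [set: I]) (`|(p i - q i) * (s i - c)|%R)%:E < +oo ->
  exists2 v : R, signed_esum (fun i => (p i - q i) * s i)%R = v%:E &
    (`|v|%R)%:E <= \esum_(i in [set: I]) (`|(p i - q i) * (s i - c)|%R)%:E.
Proof.
move=> p0 q0 p1 q1.
pose k i := ((p i - q i) * (s i - c))%R.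
pose P := \esum_(i in [set: I]) (Num.max (k i) 0%R)%:E.
pose N := \esum_(i in [set: I]) (Num.max (- k i) 0%R)%:E.
have P0 : 0 <= P by apply: esum_ge0 => i _; rewrite lee_fin le_max lexx orbT.
have N0 : 0 <= N by apply: esum_ge0 => i _; rewrite lee_fin le_max lexx orbT.
have -> : \esum_(i in [set: I]) (`|(p i - q i) * (s i - c)|%R)%:E = P + N.
  rewrite -esumD; try by move=> i _; rewrite lee_fin le_max lexx orbT.
  by apply: eq_esum => i _; rewrite -/(k i) -EFinD maxD_abs.
move=> PNoo.
have Pf : P \is a fin_num by apply: (fin_num_le P0 _ PNoo); rewrite leeDl.
have Nf : N \is a fin_num by apply: (fin_num_le N0 _ PNoo); rewrite leeDr.
pose cp := Num.max c 0%R; pose cn := Num.max (- c)%R 0%R.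
have cp0 : (0 <= cp)%R by rewrite le_max lexx orbT.
have cn0 : (0 <= cn)%R by rewrite le_max lexx orbT.
have cE : c = (cp - cn)%R by rewrite /cp /cn maxB_id.
have sumE (x y : R) (h : I -> R) : (0 <= x)%R -> (0 <= y)%R ->
    (forall i, 0 <= h i)%R ->
    \esum_(i in [set: I]) (h i + (x * p i + y * q i))%:E =
    \esum_(i in [set: I]) (h i)%:E + (x + y)%:E.
  move=> x0 y0 h0; under eq_esum do rewrite !EFinD !EFinM.
  have a0 i : 0 <= x%:E * (p i)%:E by rewrite mule_ge0 ?lee_fin.
  have b0 i : 0 <= y%:E * (q i)%:E by rewrite mule_ge0 ?lee_fin.
  rewrite esumD; [|by move=> i _; rewrite ?lee_fin|by move=> i _; exact: adde_ge0].
  rewrite esumD; [|by move=> i _..].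
  by rewrite !ge0_esumZl// p1 q1 !mule1.
exists (fine P - fine N)%R; last first.
  rewrite -[leRHS]fineK ?fin_numD ?Pf// fineD// lee_fin.
  by rewrite (le_trans (ler_normB _ _))// !ger0_norm ?fine_ge0.
rewrite (_ : (fun i => _) = fun i =>
  (Num.max (k i) 0 + (cp * p i + cn * q i)) -
  (Num.max (- k i) 0 + (cn * p i + cp * q i)))%R; last first.
  apply/funext => i; rewrite opprD addrACA.
  by rewrite maxB_id /k cE; ring.
have h0 (x : R) : (0 <= Num.max x 0)%R by rewrite le_max lexx orbT.
rewrite signed_esumB ?sumE//.
- rewrite -/P -/N; move: (fineK Pf) (fineK Nf).
  set u := fine P; set v := fine N => <- <-.
  by rewrite -!EFinD; congr EFin; ring.
- by move=> i; rewrite !addr_ge0 ?mulr_ge0.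
- by move=> i; rewrite !addr_ge0 ?mulr_ge0.
- by rewrite -/P lte_add_pinfty ?ltry ?ltey_eq ?Pf.
- by rewrite -/N lte_add_pinfty ?ltry ?ltey_eq ?Nf.
Qed.

(** Jensen's inequality, with the convex function known only through the
    supporting line [A + B * (x - V)] at the mean [V]. The positive and negative
    parts of the slope go to opposite sides, so that all sums stay nonnegative. *)
Lemma esum_tangent (p x y : I -> R) (V A B : R) :
  (forall i, 0 <= p i)%R -> (forall i, 0 <= x i)%R -> (forall i, 0 <= y i)%R ->
  (0 <= A)%R -> \esum_(i in [set: I]) (p i)%:E = 1 ->
  \esum_(i in [set: I]) (p i * x i)%:E = V%:E ->
  (forall i, A + B * (x i - V) <= y i)%R ->
  A%:E <= \esum_(i in [set: I]) (p i * y i)%:E.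
Proof.
move=> p0 x0 y0 A0 p1 pV tang.
have V0 : (0 <= V)%R.
  by rewrite -lee_fin -pV; apply: esum_ge0 => i _; rewrite lee_fin mulr_ge0.
pose b := Num.max B 0%R; pose c := Num.max (- B)%R 0%R.
have b0 : (0 <= b)%R by rewrite le_max lexx orbT.
have c0 : (0 <= c)%R by rewrite le_max lexx orbT.
have BE : B = (b - c)%R by rewrite /b /c maxB_id.
have affE (h : I -> R) (u v : R) : (forall i, 0 <= h i)%R ->
    (0 <= u)%R -> (0 <= v)%R ->
    \esum_(i in [set: I]) (p i * (h i + (u * x i + v)))%:E =
    \esum_(i in [set: I]) (p i * h i)%:E + (u * V + v)%:E.
  move=> h0 u0 v0.
  have ph i : 0 <= (p i * h i)%:E by rewrite lee_fin mulr_ge0.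
  have px i : 0 <= (p i * x i)%:E by rewrite lee_fin mulr_ge0.
  have pp i : 0 <= (p i)%:E by rewrite lee_fin.
  rewrite [X in _ + X]EFinD EFinM -pV -[v%:E]mule1 -p1 -!ge0_esumZl//.
  have upx i : 0 <= u%:E * (p i * x i)%:E by rewrite mule_ge0.
  have vp i : 0 <= v%:E * (p i)%:E by rewrite mule_ge0.
  rewrite -!esumD//; last by move=> i _; exact: adde_ge0.
  by apply: eq_esum => i _; rewrite -!EFinM -!EFinD; congr EFin; ring.
have W0 : (0 <= b * V + c * V)%R by rewrite addr_ge0 ?mulr_ge0.
have : \esum_(i in [set: I]) (p i * (A + (b * x i + c * V)))%:E <=
       \esum_(i in [set: I]) (p i * (y i + (c * x i + b * V)))%:E.
  apply: le_esum => i _; rewrite lee_fin ler_wpM2l//.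
  by have := tang i => t; rewrite BE in t; nra.
rewrite !affE ?mulr_ge0// [(c * V + _)%R]addrC leeD2rE//.
suff -> : \esum_(i in [set: I]) (p i * A)%:E = A%:E by [].
rewrite -[RHS]mule1 -p1 -ge0_esumZl//.
by apply: eq_esum => i _; rewrite -EFinM mulrC.
Qed.

Lemma esum_sqr_le (p x : I -> R) :
  (forall i, 0 <= p i)%R -> (forall i, 0 <= x i)%R ->
  \esum_(i in [set: I]) (p i)%:E = 1 ->
  \esum_(i in [set: I]) (p i * x i ^+ 2)%:E < +oo ->
  exists2 V : R, \esum_(i in [set: I]) (p i * x i)%:E = V%:E &
    (V ^+ 2)%:E <= \esum_(i in [set: I]) (p i * x i ^+ 2)%:E.
Proof.
move=> p0 x0 p1 x2oo.
have Vf : \esum_(i in [set: I]) (p i * x i)%:E \is a fin_num.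
  apply: (@fin_num_le _ (\esum_(i in [set: I]) (p i)%:E +
    \esum_(i in [set: I]) (p i * x i ^+ 2)%:E)).
  - by apply: esum_ge0 => i _; rewrite lee_fin mulr_ge0.
  - rewrite -esumD; [|by move=> i _; rewrite lee_fin ?mulr_ge0 ?sqr_ge0..].
    apply: le_esum => i _; rewrite -EFinD lee_fin -{2}(mulr1 (p i)) -mulrDr.
    rewrite ler_wpM2l//; have := sqr_ge0 (x i - 1)%R; have := x0 i.
    by move=> ? ?; nra.
  - by rewrite p1 lte_add_pinfty ?ltry.
exists (fine (\esum_(i in [set: I]) (p i * x i)%:E)); first by rewrite fineK.
set V := fine _.
have V0 : (0 <= V)%R.
  by rewrite fine_ge0//; apply: esum_ge0 => i _; rewrite lee_fin mulr_ge0.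
apply: (@esum_tangent p x (fun i => x i ^+ 2)%R V (V ^+ 2) (2 * V)) => //.
- by move=> i; exact: sqr_ge0.
- exact: sqr_ge0.
- by rewrite fineK.
- by move=> i; have := sqr_ge0 (x i - V)%R => ?; nra.
Qed.

End countable_sums.

(** * Products of one-dimensional Gaussian densities *)

Section gaussian_product.
Context {R : realType}.
Implicit Types (a v : nat -> R).

(** [v] lists variances, whereas [normal_pdf] expects a standard deviation. *)
Definition normal_prod a v d (x : 'cV[R]_d) : R :=
  \prod_(j < d) normal_pdf (a j) (Num.sqrt (v j)) (x j 0).

Lemma normal_prod_ge0 a v d (x : 'cV[R]_d) : 0 <= normal_prod a v x.
Proof. by apply: prodr_ge0 => j _; exact: normal_pdf_ge0. Qed.

Lemma normal_pdf_gt0 (a s x : R) : s != 0 -> 0 < normal_pdf a s x.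
Proof.
by move=> s0; rewrite normal_pdfE// mulr_gt0 ?normal_peak_gt0 ?expR_gt0.
Qed.

Lemma normal_prod_gt0 a v d (x : 'cV[R]_d) :
  (forall j, 0 < v j) -> 0 < normal_prod a v x.
Proof.
move=> v0; apply: prodr_gt0 => j _.
by rewrite normal_pdf_gt0// gt_eqF// sqrtr_gt0.
Qed.

Lemma measurable_coord d (j : 'I_d) : measurable_fun [set: d.-tuple R]
  (fun x : d.-tuple R => (\col_k tnth x k : 'cV[R]_d) j 0).
Proof. by under eq_fun do rewrite mxE; exact: measurable_tnth. Qed.

Lemma measurable_normal_prod a v d : measurable_fun [set: d.-tuple R]
  (fun x : d.-tuple R => normal_prod a v (\col_j tnth x j)).
Proof.
apply: measurable_prod => j _.
by apply: measurableT_comp; [exact: measurable_normal_pdf|exact: measurable_coord].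
Qed.

Lemma integral_lebesgue_tupleS d (f : d.+1.-tuple R -> \bar R) :
  measurable_fun [set: d.+1.-tuple R] f -> (forall x, (0 <= f x)%E) ->
  (\int[lebesgue_tuple R d.+1]_x f x =
   \int[lebesgue_measure]_x \int[lebesgue_tuple R d]_y f (tuple_cons (x, y)))%E.
Proof.
move=> mf f0.
have mc := @measurable_tuple_cons _ (measurableTypeR R) d.
rewrite [LHS](ge0_integral_pushforward mc)// preimage_setT fubini_tonelli1//=.
exact: (measurableT_comp mf mc).
Qed.

Lemma integral_normal_prod a v d :
  (\int[lebesgue_tuple R d]_x (normal_prod a v (\col_j tnth x j))%:E = 1)%E.
Proof.
elim: d a v => [|d ih] a v.
  under eq_integral do rewrite /normal_prod big_ord0.
  by rewrite integral_cst//= mul1e diracT.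
have mf := measurable_normal_prod a v (d := d.+1).
rewrite integral_lebesgue_tupleS; last 2 first.
  exact/measurable_EFinP.
  by move=> x; rewrite lee_fin normal_prod_ge0.
transitivity (\int[lebesgue_measure]_x (normal_pdf (a 0) (Num.sqrt (v 0)) x)%:E)%E;
  last exact: integral_normal_pdf.
apply: eq_integral => x _.
transitivity (\int[lebesgue_tuple R d]_y
  ((normal_pdf (a 0) (Num.sqrt (v 0)) x)%:E *
   (normal_prod (a \o S) (v \o S) (\col_j tnth y j))%:E))%E.
  apply: eq_integral => y _; rewrite -EFinM /normal_prod big_ord_recl mxE.
  congr (EFin (_ * _)); apply: eq_bigr => j _.
  by rewrite !mxE [in LHS]/tuple_cons tnthS/=.
rewrite ge0_integralZl_EFin// ?ih ?mule1//.
- by move=> y _; rewrite lee_fin normal_prod_ge0.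
- by apply/measurable_EFinP; exact: measurable_normal_prod.
- exact: normal_pdf_ge0.
Qed.

Lemma invmx_diag_mx n (d : 'rV[R]_n) : (forall j, d 0 j != 0) ->
  invmx (diag_mx d) = diag_mx (\row_j (d 0 j)^-1).
Proof.
move=> d0; set e := \row_j _.
have DE : diag_mx d *m diag_mx e = 1%:M.
  rewrite mulmx_diag -diag_const_mx; congr diag_mx; apply/rowP => j.
  by rewrite !mxE divff.
have [Du _] := mulmx1_unit DE.
by rewrite -[LHS]mulmx1 -DE mulmxA mulVmx// mul1mx.
Qed.

Lemma normal_pdf_sqrt (b v x : R) : 0 < v -> normal_pdf b (Num.sqrt v) x =
  expR (- ((x - b) ^+ 2 / (2 * v))) / Num.sqrt (2 * pi * v).
Proof.
move=> v0; rewrite normal_pdfE ?gt_eqF ?sqrtr_gt0//.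
rewrite /normal_peak /normal_fun sqr_sqrtr ?ltW// mulrC; congr (expR _ / Num.sqrt _).
  by rewrite mulNr -mulr_natl.
by rewrite -mulr_natr; ring.
Qed.

Lemma gaussian_pdf_diag a v d (x : 'cV[R]_d) : (forall j, 0 < v j) ->
  gaussian_pdf (\col_(j < d) a j) (diag_mx (\row_(j < d) v j)) x =
  normal_prod a v x.
Proof.
move=> v0; rewrite /gaussian_pdf /normal_prod.
rewrite invmx_diag_mx; last by move=> j; rewrite mxE gt_eqF.
under [RHS]eq_bigr do rewrite normal_pdf_sqrt//.
rewrite big_split/= -expR_sum; congr (expR _ * _).
  rewrite -mulmxA mul_diag_mx mxE mulr_suml -sumrN; apply: eq_bigr => j _.
  rewrite !mxE; congr (- _); rewrite expr2 -mulrA [2 * _]mulrC invfM.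
  by ring.
rewrite prodfV; congr (_^-1).
rewrite det_diag -{1}(card_ord d) -prodr_const -big_split/=.
under eq_bigr do rewrite mxE.
elim/big_rec2: _ => [|j u p _ <-]; first by rewrite sqrtr1.
by rewrite sqrtrM// ltW// !mulr_gt0// pi_gt0.
Qed.

Lemma comp_pdfE (I : countType) (T : R) lambda (m s : I -> nat -> R) d i t
    (x : 'cV[R]_d) : (forall j, 0 < modevar T lambda s i t j) ->
  comp_pdf T lambda m s i t x = normal_prod (m i) (modevar T lambda s i t) x.
Proof. exact: gaussian_pdf_diag. Qed.

Lemma scoreE (I : countType) (T : R) lambda (m s : I -> nat -> R) d i t
    (x : 'cV[R]_d) j : (forall j, 0 < modevar T lambda s i t j) ->
  score T lambda m s i t x j 0 = - ((x j 0 - m i j) / modevar T lambda s i t j).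
Proof.
move=> v0; rewrite /score /cov_mx invmx_diag_mx; last by move=> k; rewrite mxE gt_eqF.
by rewrite mul_diag_mx !mxE mulrC.
Qed.

End gaussian_product.

(** * One-dimensional estimates *)

Section one_dimensional.
Context {R : realType}.
Implicit Types (s b v x : R).

Definition log_normal_pdf b v x : R :=
  - ((x - b) ^+ 2 / (2 * v)) - ln (2 * pi * v) / 2.

Lemma normal_pdf_expR b v x : 0 < v ->
  normal_pdf b (Num.sqrt v) x = expR (log_normal_pdf b v x).
Proof.
move=> v0; have pv : 0 < 2 * pi * v by rewrite !mulr_gt0// pi_gt0.
rewrite normal_pdf_sqrt// expRD; congr (_ * _).
rewrite expRN; congr (_^-1); apply: (@pexpIrn _ 2) => //; rewrite ?nnegrE ?expR_ge0//.
by rewrite sqr_sqrtr ?(ltW pv)// expr2 -expRD -splitr lnK// posrE.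
Qed.

(** Apply [ln z <= z - 1] to [z = (1 + y)^-1]. *)
Lemma ln1D_ge y c : 0 < c -> c <= 1 + y -> y - y ^+ 2 / c <= ln (1 + y) :> R.
Proof.
move=> c0 cy; have y0 : 0 < 1 + y by exact: lt_le_trans cy.
have : ln (1 + y)^-1 <= (1 + y)^-1 - 1.
  have := @le_ln1Dx R ((1 + y)^-1 - 1).
  rewrite (_ : 1 + (_ - 1) = (1 + y)^-1); last by rewrite addrC subrK.
  apply.
  by rewrite ltrBrDr addNr invr_gt0.
rewrite lnV ?posrE// => h.
have yc : y ^+ 2 / (1 + y) <= y ^+ 2 / c by rewrite ler_wpM2l ?sqr_ge0// lef_pV2 ?posrE.
have yE : y ^+ 2 / (1 + y) = y - (1 - (1 + y)^-1) by field; rewrite gt_eqF.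
by rewrite yE in yc; lra.
Qed.

(** The tilt [phi^(1 - s) * phi'^s] of the densities of [N(b, v)] and [N(b', v')]
    is a multiple of the density of [N(tilt_mean, tilt_var)]; the logarithm of
    the multiple is [tilt_log_mass]. *)
Definition tilt_den s v v' : R := v + (1 - s) * (v' - v).
Definition tilt_var s v v' : R := v * v' / tilt_den s v v'.
Definition tilt_mean s b b' v v' : R :=
  (s * v * b' + (1 - s) * v' * b) / tilt_den s v v'.
Definition tilt_log_mass s b b' v v' : R :=
  (1 - s) / 2 * ln (v' / v) - ln (tilt_den s v v' / v) / 2
  + s * (s - 1) / 2 * ((b' - b) ^+ 2 / tilt_den s v v').

(** Complete the square in the exponent. *)
Lemma log_normal_pdf_tilt s b b' v v' x : 0 < v -> 0 < v' ->
  0 < tilt_den s v v' ->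
  log_normal_pdf b v x + s * (log_normal_pdf b' v' x - log_normal_pdf b v x) =
  log_normal_pdf (tilt_mean s b b' v v') (tilt_var s v v') x
  + tilt_log_mass s b b' v v'.
Proof.
move=> v0 v'0; rewrite /log_normal_pdf /tilt_mean /tilt_var /tilt_log_mass.
move E : (tilt_den s v v') => D D0.
have p0 : 0 < pi :> R by exact: pi_gt0.
rewrite !lnM ?lnV ?posrE ?mulr_gt0 ?invr_gt0// ?lnV ?posrE//.
have -> : (x - (s * v * b' + (1 - s) * v' * b) / D) ^+ 2 / (2 * (v * v' / D)) =
   (1 - s) * ((x - b) ^+ 2 / (2 * v)) + s * ((x - b') ^+ 2 / (2 * v'))
   + s * (s - 1) / 2 * ((b' - b) ^+ 2 / D).
  have D0' : v + (1 - s) * (v' - v) != 0 by rewrite gt_eqF// -/(tilt_den s v v') E.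
  by rewrite -E /tilt_den; field; rewrite D0' !gt_eqF.
by field; rewrite !gt_eqF.
Qed.

(** To first order in the relative variance change [q] the two logarithms
    cancel, so that only quadratic terms remain. For [|s| <= 8] their
    coefficients are at most [|1 - s| / 2 + (1 - s)^2 / 2 <= 45] and
    [s * (s - 1) / 2 <= 36]. *)
Lemma tilt_log_mass_le s b b' v v' c : 0 < v -> 0 < v' -> 0 < c ->
  c <= v' / v -> c <= tilt_den s v v' / v -> -8 <= s <= 8 ->
  tilt_log_mass s b b' v v' <=
    45 / c * (((v' - v) / v) ^+ 2 + (b' - b) ^+ 2 / v).
Proof.
move=> v0 v'0 c0 cv' cD s8.
have vn0 : v != 0 by rewrite gt_eqF.
set q := (v' - v) / v; set e := (b' - b) ^+ 2 / v.
have v'E : v' / v = 1 + q by rewrite /q mulrBl divff// addrC subrK.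
have DE : tilt_den s v v' / v = 1 + (1 - s) * q by rewrite /tilt_den /q; field.
have D0 : 0 < tilt_den s v v'.
  by rewrite -(pmulr_lgt0 _ (_ : 0 < v^-1)) ?invr_gt0//; exact: lt_le_trans cD.
have e0 : 0 <= e by rewrite /e divr_ge0 ?sqr_ge0// ltW.
have eD : (b' - b) ^+ 2 / tilt_den s v v' <= e / c.
  rewrite /e -mulrA -invfM ler_wpM2l ?sqr_ge0// lef_pV2 ?posrE ?mulr_gt0//.
  by move: cD; rewrite ler_pdivlMr// mulrC.
rewrite /tilt_log_mass v'E DE; rewrite v'E in cv'; rewrite DE in cD.
have l1 := ln1D_ge c0 cv'.
have l2 := ln1D_ge c0 cD.
have l3 : ln (1 + q) <= q by apply: le_ln1Dx; lra.
have f0 : 0 <= (b' - b) ^+ 2 / tilt_den s v v' by rewrite divr_ge0 ?sqr_ge0// ltW.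
have Q0 : 0 <= q ^+ 2 / c by rewrite divr_ge0 ?sqr_ge0// ltW.
have E0 : 0 <= e / c by rewrite divr_ge0// ltW.
have -> : 45 / c * (q ^+ 2 + e) = 45 * (q ^+ 2 / c) + 45 * (e / c).
  by field; rewrite gt_eqF.
move: l1 l2 l3 eD f0; rewrite [((1 - s) * q) ^+ 2]exprMn -(mulrA _ (q ^+ 2)).
move: (q ^+ 2 / c) (e / c) (ln (1 + q)) (ln (1 + (1 - s) * q)) (_ / tilt_den _ _ _) Q0 E0.
move=> Q E l l' f Q0 E0 l1 l2 l3 fE f0.
have t1 : (1 - s) / 2 * (l - q) <= 9 / 2 * Q.
  have [s1|s1] := orP (le_total 0 (1 - s)).
    have lq : l - q <= 0 by lra.
    have := mulr_ge0_le0 s1 lq => ?; lra.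
  have -> : (1 - s) / 2 * (l - q) = (s - 1) / 2 * (q - l) by field.
  rewrite ler_pM//; lra.
have t2 : (1 - s) ^+ 2 * Q <= 81 * Q by rewrite ler_wpM2r//; nra.
have t3 : s * (s - 1) / 2 * f <= 36 * f by rewrite ler_wpM2r//; nra.
by lra.
Qed.

Lemma quartic_exp_le (y : R) : 0 <= y -> y ^+ 2 <= 2 * expR y.
Proof.
move=> y0; have := expR_ge1Dxn 1 y0.
by rewrite (_ : 2`! = 2)%N// => h; lra.
Qed.

(** Since [z^4 * exp(- z^2 / 2) <= 32 * exp(- z^2 / 4)], a quartic factor is
    absorbed by doubling the variance. *)
Lemma normal_pdf_moment4 b v A mu x : 0 < v ->
  normal_pdf b (Num.sqrt v) x * (A * (x - b) + mu) ^+ 4 <=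
  512 * (A ^+ 2 * v + mu ^+ 2) ^+ 2 *
  (normal_pdf b (Num.sqrt v) x + normal_pdf b (Num.sqrt (2 * v)) x).
Proof.
move=> v0; have vn0 : v != 0 by rewrite gt_eqF.
have h4 : normal_pdf b (Num.sqrt v) x * (x - b) ^+ 4 <=
    64 * v ^+ 2 * normal_pdf b (Num.sqrt (2 * v)) x.
  rewrite !normal_pdf_sqrt ?mulr_gt0//.
  set h := x - b; pose y := h ^+ 2 / (4 * v).
  have y0 : 0 <= y by rewrite divr_ge0 ?sqr_ge0// mulr_ge0// ltW.
  have -> : - (h ^+ 2 / (2 * v)) = - y - y by rewrite /y; field.
  have -> : - (h ^+ 2 / (2 * (2 * v))) = - y by rewrite /y; field.
  have -> : h ^+ 4 = 16 * v ^+ 2 * y ^+ 2 by rewrite /y; field.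
  have pv : 0 < 2 * pi * v by rewrite !mulr_gt0// pi_gt0.
  have -> : 2 * pi * (2 * v) = 2 * (2 * pi * v) by ring.
  rewrite [Num.sqrt (2 * (2 * pi * v))]sqrtrM// invfM expRD.
  set P := Num.sqrt (2 * pi * v); have P0 : 0 < P^-1 by rewrite invr_gt0 sqrtr_gt0.
  have yE : expR (- y) * y ^+ 2 <= 2.
    by rewrite expRN mulrC ler_pdivrMr ?expR_gt0// quartic_exp_le.
  have s2 : 1 <= 2 / Num.sqrt 2 :> R.
    by rewrite -{1}(@sqr_sqrtr R 2)// expr2 mulfK ?gt_eqF ?sqrtr_gt0// -{1}sqrtr1 ler_wsqrtr// ler1n.
  have X0 : 0 <= expR (- y) * P^-1 * v ^+ 2.
    by rewrite !mulr_ge0 ?expR_ge0 ?sqr_ge0// ltW.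
  have -> : expR (- y) * expR (- y) / P * (16 * v ^+ 2 * y ^+ 2) =
    expR (- y) * P^-1 * v ^+ 2 * (16 * (expR (- y) * y ^+ 2)) by ring.
  have -> : 64 * v ^+ 2 * (expR (- y) * ((Num.sqrt 2)^-1 * P^-1)) =
    expR (- y) * P^-1 * v ^+ 2 * (32 * (2 / Num.sqrt 2)) by ring.
  by rewrite ler_wpM2l//; lra.
set f := normal_pdf _ _ _ in h4 *; set g := normal_pdf _ _ _ in h4 *.
have f0 : 0 <= f by exact: normal_pdf_ge0.
have g0 : 0 <= g by exact: normal_pdf_ge0.
set h := x - b in h4 *.
have sum4 : (A * h + mu) ^+ 4 <= 8 * (A ^+ 4 * h ^+ 4 + mu ^+ 4).
  set z := A * h; have -> : A ^+ 4 * h ^+ 4 = z ^+ 4 by rewrite -exprMn.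
  have sq2 : (z + mu) ^+ 2 <= 2 * (z ^+ 2 + mu ^+ 2) by have := sqr_ge0 (z - mu) => ?; nra.
  have : ((z + mu) ^+ 2) ^+ 2 <= (2 * (z ^+ 2 + mu ^+ 2)) ^+ 2.
    by rewrite lerXn2r// nnegrE ?sqr_ge0// mulr_ge0// addr_ge0 ?sqr_ge0.
  rewrite -exprM exprMn => /le_trans; apply.
  have := sqr_ge0 (z ^+ 2 - mu ^+ 2).
  have -> : z ^+ 4 = (z ^+ 2) ^+ 2 by ring.
  have -> : mu ^+ 4 = (mu ^+ 2) ^+ 2 by ring.
  move: (z ^+ 2) (mu ^+ 2) => p q; rewrite !expr2 => ?; lra.
apply: (@le_trans _ _ (8 * (A ^+ 4 * (f * h ^+ 4) + mu ^+ 4 * f))).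
  apply: (le_trans (ler_wpM2l f0 sum4)); rewrite le_eqVlt; apply/orP; left.
  by apply/eqP; ring.
apply: (@le_trans _ _ (512 * (A ^+ 4 * v ^+ 2 * g + mu ^+ 4 * f))).
  have A4 : 0 <= A ^+ 4 by rewrite (exprM A 2 2) sqr_ge0.
  have m4 : 0 <= mu ^+ 4 * f by rewrite mulr_ge0// (exprM mu 2 2) sqr_ge0.
  have := ler_wpM2l A4 h4 => ?; lra.
rewrite -[leRHS]mulrA; apply: ler_wpM2l; first by rewrite ler0n.
have a0 : 0 <= A ^+ 2 * v by rewrite mulr_ge0 ?sqr_ge0// ltW.
have m0 : 0 <= mu ^+ 2 by exact: sqr_ge0.
have -> : A ^+ 4 * v ^+ 2 = (A ^+ 2 * v) ^+ 2 by ring.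
have -> : mu ^+ 4 = (mu ^+ 2) ^+ 2 by ring.
move: (A ^+ 2 * v) (mu ^+ 2) a0 m0 => p q p0 q0.
rewrite mulrDr addrC lerD// ler_wpM2r//.
  by rewrite lerXn2r ?nnegrE ?addr_ge0// lerDr.
by rewrite lerXn2r ?nnegrE ?addr_ge0// lerDl.
Qed.

End one_dimensional.

(** * Upper integrals of products of Gaussian densities *)

(** The integral of a nonnegative function is a supremum over the simple
    functions below it. This makes the domination of an integrand such as the
    one built from [I2] sufficient, whatever its measurability. *)
Lemma ge0_le_upper_integral d (X : measurableType d) (R : realType)
    (mu : {measure set X -> \bar R}) (f g : X -> \bar R) :
  (forall x, 0 <= f x)%E -> (forall x, f x <= g x)%E ->
  (\int[mu]_x f x <= \int[mu]_x g x)%E.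
Proof.
move=> f0 fg; have g0 x : (0 <= g x)%E := le_trans (f0 x) (fg x).
rewrite !ge0_integralTE//; apply: le_ereal_sup => _ [h hf <-]; exists h => // x.
exact: le_trans (hf x) (fg x).
Qed.

Section upper_integral.
Context {R : realType} {d : nat}.
Implicit Types (H K : 'cV[R]_d -> R) (C D : R) (a v : nat -> R).

(** Measurability is asked of the dominating function [h], which below is
    always a combination of Gaussian densities, and not of [H], which contains
    ratios of densities. *)
Definition upper_integral_le H C := exists h : d.-tuple R -> R,
  [/\ measurable_fun [set: d.-tuple R] h, forall x, 0 <= h x,
      (\int[lebesgue_tuple R d]_x (h x)%:E <= C%:E)%E &
      forall x : d.-tuple R, H (\col_j tnth x j) <= h x].

Lemma upper_integral_le_mono H K C D : (forall x, H x <= K x) -> C <= D ->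
  upper_integral_le K C -> upper_integral_le H D.
Proof.
move=> HK CD [h [mh h0 hC Kh]]; exists h; split => //.
  by apply: (le_trans hC); rewrite lee_fin.
by move=> x; exact: le_trans (HK _) (Kh x).
Qed.

Lemma upper_integral_leD H K C D : upper_integral_le H C ->
  upper_integral_le K D -> upper_integral_le (fun x => H x + K x) (C + D).
Proof.
move=> [h [mh h0 hC Hh]] [k [mk k0 kD Kk]]; exists (fun x => h x + k x); split.
- exact: measurable_funD.
- by move=> x; rewrite addr_ge0.
- under eq_integral do rewrite EFinD.
  rewrite ge0_integralD//; first by rewrite EFinD leeD.
  + by move=> x _; rewrite lee_fin.
  + exact/measurable_EFinP.
  + by move=> x _; rewrite lee_fin.
  + exact/measurable_EFinP.
- by move=> x; rewrite lerD.
Qed.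

Lemma upper_integral_leZ (k : R) H C : 0 <= k -> upper_integral_le H C ->
  upper_integral_le (fun x => k * H x) (k * C).
Proof.
move=> k0 [h [mh h0 hC Hh]]; exists (fun x => k * h x); split.
- exact: measurable_funM.
- by move=> x; rewrite mulr_ge0.
- under eq_integral do rewrite EFinM.
  rewrite ge0_integralZl_EFin//; first by rewrite EFinM lee_wpmul2l// lee_fin.
  + by move=> x _; rewrite lee_fin.
  + exact/measurable_EFinP.
- by move=> x; rewrite ler_wpM2l.
Qed.

Lemma upper_integral_le_sum n (H : 'I_n -> 'cV[R]_d -> R) (C : 'I_n -> R) :
  (forall k, upper_integral_le (H k) (C k)) ->
  upper_integral_le (fun x => \sum_(k < n) H k x) (\sum_(k < n) C k).
Proof.
elim: n H C => [|n ih] H C HC.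
  exists (fun=> 0); split => //; first by rewrite integral0 big_ord0.
  by move=> x; rewrite big_ord0.
apply: (@upper_integral_le_mono _
  (fun x => H ord0 x + \sum_(k < n) H (lift ord0 k) x)
  (C ord0 + \sum_(k < n) C (lift ord0 k))).
- by move=> x; rewrite big_ord_recl.
- by rewrite [leRHS]big_ord_recl.
- by apply: upper_integral_leD => //; apply: ih.
Qed.

Lemma upper_integral_normal_prod a v : upper_integral_le (normal_prod a v (d := d)) 1.
Proof.
exists (fun x => normal_prod a v (\col_j tnth x j)); split => //.
- exact: measurable_normal_prod.
- by move=> x; exact: normal_prod_ge0.
- by rewrite integral_normal_prod.
Qed.

Lemma normal_prod_expR a v (x : 'cV[R]_d) : (forall j, 0 < v j) ->
  normal_prod a v x = expR (\sum_(j < d) log_normal_pdf (a j) (v j) (x j 0)).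
Proof.
by move=> v0; rewrite expR_sum; apply: eq_bigr => j _; rewrite normal_pdf_expR.
Qed.

(** The tilt factorizes over the coordinates, so the logarithms of the masses
    add up. *)
Lemma upper_integral_tilt (s : R) a a' v v' (B : nat -> R) :
  (forall j, 0 < v j) -> (forall j, 0 < v' j) ->
  (forall j, 0 < tilt_den s (v j) (v' j)) ->
  (forall j, tilt_log_mass s (a j) (a' j) (v j) (v' j) <= B j) ->
  upper_integral_le (fun x => normal_prod a v x *
      expR (s * ln (normal_prod a' v' x / normal_prod a v x)))
    (expR (\sum_(j < d) B j)).
Proof.
move=> v0 v'0 D0 massB.
pose b j := tilt_mean s (a j) (a' j) (v j) (v' j).
pose u j := tilt_var s (v j) (v' j).
have u0 j : 0 < u j by rewrite /u /tilt_var divr_gt0 ?mulr_gt0.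
apply: (@upper_integral_le_mono _
  (fun x => expR (\sum_(j < d) B j) * normal_prod b u x)
  (expR (\sum_(j < d) B j) * 1)); last 2 first.
- by rewrite mulr1.
- by apply: upper_integral_leZ; [exact: expR_ge0|exact: upper_integral_normal_prod].
move=> x; rewrite lnM ?lnV ?posrE ?invr_gt0 ?normal_prod_gt0//.
rewrite !normal_prod_expR// !expRK -!expRD ler_expR.
rewrite -sumrB mulr_sumr -!big_split/=; apply: ler_sum => j _.
by rewrite log_normal_pdf_tilt// [leRHS]addrC lerD2l.
Qed.

Lemma normal_prod_moment4 a v (k : 'I_d) (A mu : R) (x : 'cV[R]_d) :
  (forall j, 0 < v j) ->
  normal_prod a v x * (A * (x k 0 - a k) + mu) ^+ 4 <=
  512 * (A ^+ 2 * v k + mu ^+ 2) ^+ 2 *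
  (normal_prod a v x
   + normal_prod a (fun j => if j == k :> nat then 2 * v j else v j) x).
Proof.
move=> v0; rewrite /normal_prod.
rewrite (bigD1 k)//= [X in _ <= _ * (_ + X)](bigD1 k)//= eqxx.
rewrite [X in _ <= _ * (_ + _ * X)](eq_bigr (fun j : 'I_d =>
  normal_pdf (a j) (Num.sqrt (v j)) (x j 0))); last first.
  by move=> j jk; rewrite ifN.
set P := \prod_(_ < _ | _) _.
have P0 : 0 <= P by apply: prodr_ge0 => j _; exact: normal_pdf_ge0.
rewrite -mulrDl mulrA mulrAC ler_wpM2r//.
exact: normal_pdf_moment4.
Qed.

(** Cauchy--Schwarz for the weights [g j * q j]. Where [q j = 0] the convention
    [0^-1 = 0] drops the term, and [z j] vanishes as well. *)
Lemma sqr_sum_le (n : nat) (g q z : 'I_n -> R) :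
  (forall j, 0 <= g j) -> (forall j, 0 <= q j) -> (forall j, q j = 0 -> z j = 0) ->
  (\sum_j g j * z j) ^+ 2 <=
  (\sum_j g j * q j) * \sum_j g j * (z j ^+ 2 / q j).
Proof.
move=> g0 q0 qz; set S := \sum_j g j * z j; set Q := \sum_j g j * q j.
have Q0 : 0 <= Q by apply: sumr_ge0 => j _; rewrite mulr_ge0.
have [Qz|Qn] := eqVneq Q 0.
  suff -> : S = 0 by rewrite Qz expr0n mul0r.
  apply: big1 => j _; have /eqP := Qz; rewrite psumr_eq0; last first.
    by move=> k _; rewrite mulr_ge0.
  move=> /allP/(_ j); rewrite mem_index_enum => /(_ isT)/=.
  by rewrite mulf_eq0 => /orP[/eqP->|/eqP/qz->]; rewrite ?mul0r ?mulr0.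
pose c := S / Q.
suff : \sum_j g j * (2 * c * z j - c ^+ 2 * q j) <= \sum_j g j * (z j ^+ 2 / q j).
  move=> /(ler_wpM2l Q0); apply: le_trans.
  rewrite (eq_bigr (fun j => 2 * c * (g j * z j) - c ^+ 2 * (g j * q j))); last first.
    by move=> j _; ring.
  rewrite sumrB -!mulr_sumr -/S -/Q le_eqVlt; apply/orP; left; apply/eqP.
  by rewrite /c; field.
apply: ler_sum => j _; apply: ler_wpM2l => //.
have [qj|qj] := eqVneq (q j) 0; first by rewrite qz// qj expr0n/= !mulr0 subr0 mul0r.
have qj0 : 0 < q j by rewrite lt_neqAle eq_sym qj q0.
rewrite ler_pdivlMr//; have := sqr_ge0 (z j - c * q j) => h.
by rewrite -subr_ge0; nra.
Qed.

(** With [q j] the second moment of the [j]-th affine function, Cauchy--Schwarz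
    replaces the products of two squares by single fourth powers divided by
    [q j], whose integrals are of order [q j]. *)
Lemma upper_integral_sqr_sum a v (g A mu : 'I_d -> R) :
  (forall j, 0 < v j) -> (forall j, 0 <= g j) ->
  upper_integral_le (fun x => normal_prod a v x *
      (\sum_(j < d) g j * (A j * (x j 0 - a j) + mu j) ^+ 2) ^+ 2)
    (1024 * (\sum_(j < d) g j * (A j ^+ 2 * v j + mu j ^+ 2)) ^+ 2).
Proof.
move=> v0 g0; pose q j := A j ^+ 2 * v j + mu j ^+ 2.
pose V (k : 'I_d) (j : nat) := if j == k :> nat then 2 * v j else v j.
have Av0 j : 0 <= A j ^+ 2 * v j by rewrite mulr_ge0 ?sqr_ge0// ltW.
have q0 j : 0 <= q j by rewrite addr_ge0 ?sqr_ge0.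
rewrite -/(\sum_(j < d) g j * q j); set Q := \sum_(j < d) g j * q j.
have Q0 : 0 <= Q by apply: sumr_ge0 => j _; rewrite mulr_ge0.
apply: (@upper_integral_le_mono _ (fun x => Q * \sum_(j < d)
    (g j * (512 * q j)) * (normal_prod a v x + normal_prod a (V j) x))
  (Q * \sum_(j < d) (g j * (512 * q j)) * (1 + 1))); last 2 first.
- rewrite (eq_bigr (fun j => 1024 * (g j * q j))); last by move=> j _; ring.
  by rewrite -mulr_sumr -/Q le_eqVlt; apply/orP; left; apply/eqP; ring.
- apply: upper_integral_leZ => //; apply: upper_integral_le_sum => j.
  apply: upper_integral_leZ.
    exact: (mulr_ge0 (g0 j) (mulr_ge0 (ler0n _ _) (q0 j))).
  by apply: upper_integral_leD; exact: upper_integral_normal_prod.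
move=> x; pose y j := A j * (x j 0 - a j) + mu j.
have N0 : 0 <= normal_prod a v x by exact: normal_prod_ge0.
have qy j : q j = 0 -> y j ^+ 2 = 0.
  move=> /eqP; rewrite paddr_eq0 ?sqr_ge0// => /andP[].
  rewrite mulf_eq0 [v j == 0]gt_eqF// orbF !sqrf_eq0 /y => /eqP-> /eqP->.
  by rewrite mul0r addr0 expr0n.
have := sqr_sum_le g0 q0 qy; move=> /(ler_wpM2l N0)/le_trans; apply.
rewrite -/Q mulrCA ler_wpM2l// mulr_sumr; apply: ler_sum => j _.
rewrite mulrCA -[leRHS]mulrA ler_wpM2l//.
have [qj|qj] := eqVneq (q j) 0.
  by rewrite qj invr0 !mulr0 mul0r.
have qj0 : 0 < q j by rewrite lt_neqAle eq_sym qj q0.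
rewrite mulrA ler_pdivrMr// -exprM.
apply: (le_trans (normal_prod_moment4 _ _ _ _ _ v0)).
by rewrite le_eqVlt; apply/orP; left; apply/eqP; rewrite -/(q j) -/(V j); ring.
Qed.

End upper_integral.

(** * Pointwise bound for the reweighted score *)

Section pointwise.
Context {R : realType} {I : countType}.

Lemma one_sub_pow4_le (y : R) : 0 <= y -> (1 - y) ^+ 4 <= 8 * (1 + y ^+ 4).
Proof.
move=> y0; have := sqr_ge0 (y ^+ 2 + 2 * y + 1).
have := sqr_ge0 (y ^+ 2 - 1); have := sqr_ge0 (y - 1).
have -> : (1 - y) ^+ 4 = ((1 - y) ^+ 2) ^+ 2 by ring.
have -> : y ^+ 4 = (y ^+ 2) ^+ 2 by ring.
move=> h1 h2 h3.
have z1 : (1 - y) ^+ 2 <= 2 * (1 + y ^+ 2) by have := sqr_ge0 (1 + y) => ?; nra.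
have : ((1 - y) ^+ 2) ^+ 2 <= (2 * (1 + y ^+ 2)) ^+ 2.
  by rewrite lerXn2r// nnegrE ?sqr_ge0// mulr_ge0// addr_ge0 ?sqr_ge0.
move=> /le_trans; apply; rewrite exprMn.
move: (y ^+ 2) h2 => z; rewrite !expr2 => ?; lra.
Qed.

(** Tangent line at [1] of the convex function [y^-8]: [8 y^9 - 9 y^8 + 1] is
    [(y - 1)^2] times a polynomial with positive coefficients. *)
Lemma inv_pow8_tangent (y : R) : 0 < y -> 9 - 8 * y <= y^-1 ^+ 8.
Proof.
move=> y0; rewrite exprVn -[leRHS]mul1r ler_pdivlMr ?exprn_gt0//.
rewrite -subr_ge0 (_ : _ - _ = (y - 1) ^+ 2 * (8 * y ^+ 7 + 7 * y ^+ 6 + 6 * y ^+ 5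
  + 5 * y ^+ 4 + 4 * y ^+ 3 + 3 * y ^+ 2 + 2 * y + 1)); last by ring.
by rewrite mulr_ge0 ?sqr_ge0// !addr_ge0 ?mulr_ge0 ?exprn_ge0 ?ler0n ?(ltW y0).
Qed.

Lemma esum_EFinZl (k : R) (f : I -> R) : 0 <= k -> (forall i, 0 <= f i) ->
  (\esum_(i in [set: I]) (k * f i)%:E = k%:E * \esum_(i in [set: I]) (f i)%:E)%E.
Proof.
by move=> k0 f0; rewrite -ge0_esumZl//; apply: eq_esum => i _; rewrite EFinM.
Qed.

Definition sq_dist d (g c y : 'I_d -> R) : R := \sum_(j < d) g j * (y j - c j) ^+ 2.

(** What Young's and Jensen's inequalities leave of [(1 - u / U)^2 * D]; see
    [reweighting_bound]. *)
Definition cost (u D : R) : R := 4 + 2 * (u ^+ 8 + u^-1 ^+ 8) + D ^+ 2 / 2.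

Lemma cost_ge0 u D : 0 <= u -> 0 <= cost u D.
Proof.
move=> u0; rewrite !addr_ge0 ?ler0n// ?divr_ge0 ?sqr_ge0 ?ler0n//.
by rewrite mulr_ge0 ?ler0n// addr_ge0 ?exprn_ge0 ?invr_ge0.
Qed.

(** The reweighted probabilities are [p i * u i / U] with [U] the mean of [u].
    The reciprocal of [U] is controlled by Jensen's inequality, so that eighth
    moments of [u] and of [u^-1] suffice. Since both weights sum to [1], any
    constant [c j] may be subtracted from [s i j]. *)
Lemma reweighting_bound (p u : I -> R) d (g c : 'I_d -> R)
    (s : I -> 'I_d -> R) (l : I) :
  (forall i, 0 < p i) -> (forall i, 0 < u i) -> (forall j, 0 < g j) ->
  (\esum_(i in [set: I]) (p i)%:E = 1)%E ->
  (\esum_(i in [set: I]) (p i * cost (u i) (sq_dist g c (s i)))%:E < +oo)%E ->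
  exists U : R, [/\ 0 < U, (\esum_(i in [set: I]) (p i * u i)%:E = U%:E)%E &
    exists2 v : 'I_d -> R,
      forall j, signed_esum (fun i => (p i - p i * u i / U) * s i j) = (v j)%:E &
      ((\sum_(j < d) g j * v j ^+ 2)%:E <=
       \esum_(i in [set: I]) (p i * cost (u i) (sq_dist g c (s i)))%:E)%E].
Proof.
move=> p0 u0 g0 p1; set E := esum _ _ => Eoo.
pose D i := sq_dist g c (s i).
have p0' i : 0 <= p i by exact: ltW.
have u0' i : 0 <= u i by exact: ltW.
have D0 i : 0 <= D i.
  by apply: sumr_ge0 => j _; rewrite mulr_ge0 ?sqr_ge0// ltW.
have pu0 i : 0 <= p i * u i by rewrite mulr_ge0.
have uN0 i : 0 <= (u i)^-1 ^+ 8 by rewrite exprn_ge0// invr_ge0.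
have u80 i : 0 <= u i ^+ 8 by rewrite exprn_ge0.
have D20 i : 0 <= D i ^+ 2 / 2 by rewrite divr_ge0 ?sqr_ge0 ?ler0n.
have u_le i : u i <= 1 + u i ^+ 8.
  have [u1|u1] := orP (le_total (u i) 1); first by rewrite (le_trans u1)// lerDl.
  by rewrite ler_wpDl// -{1}(expr1 (u i)) ler_weXn2l.
have Uf : (\esum_(i in [set: I]) (p i * u i)%:E)%E \is a fin_num.
  apply: fin_num_le Eoo; first by apply: esum_ge0 => i _; rewrite lee_fin.
  apply: le_esum => i _; rewrite lee_fin ler_wpM2l// /cost -/(D i).
  by have := u_le i; have := uN0 i; have := u80 i; have := D20 i => *; lra.
pose U := fine (\esum_(i in [set: I]) (p i * u i)%:E)%E.
have UE : (\esum_(i in [set: I]) (p i * u i)%:E = U%:E)%E by rewrite fineK.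
have U0 : 0 < U.
  apply: (@lt_le_trans _ _ (p l * u l)); first by rewrite mulr_gt0.
  rewrite -lee_fin -UE.
  by apply: (@esum_ge_term _ _ (fun i => (p i * u i)%:E)) => i; rewrite lee_fin.
have Un0 : U != 0 by rewrite gt_eqF.
(* Jensen's inequality for [y^-8], rescaled by the mean [U]. *)
have UN : ((U^-1 ^+ 8)%:E <= \esum_(i in [set: I]) (p i * (u i)^-1 ^+ 8)%:E)%E.
  have UN0 : 0 <= U^-1 ^+ 8 by rewrite exprn_ge0// invr_ge0 ltW.
  apply: (@esum_tangent _ _ p u _ U _ (- 8 * U^-1 ^+ 8 / U)) => // i.
  have := inv_pow8_tangent (divr_gt0 (u0 i) U0).
  move=> /(ler_wpM2l UN0).
  have -> : U^-1 ^+ 8 * (u i / U)^-1 ^+ 8 = (u i)^-1 ^+ 8.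
    by rewrite -exprMn invfM invrK mulrCA mulVf// mulr1.
  apply: le_trans.
  by rewrite le_eqVlt; apply/orP; left; apply/eqP; field.
pose y i := u i / U.
have y0 i : 0 <= y i by rewrite divr_ge0// ltW.
(* [L] is the cost with [u i ^-8] replaced by [U ^-8]. *)
pose L i := 4 + 2 * u i ^+ 8 + D i ^+ 2 / 2 + 2 * U^-1 ^+ 8.
have yL i : (1 - y i) ^+ 2 * D i <= L i.
  have h1 := one_sub_pow4_le (y0 i).
  have h2 : (1 - y i) ^+ 2 * D i <= (1 - y i) ^+ 4 / 2 + D i ^+ 2 / 2.
    have -> : (1 - y i) ^+ 4 = ((1 - y i) ^+ 2) ^+ 2 by ring.
    by move: ((1 - y i) ^+ 2) => z; have := sqr_ge0 (z - D i) => ?; nra.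
  have h3 : y i ^+ 4 <= u i ^+ 8 / 2 + U^-1 ^+ 8 / 2.
    rewrite /y exprMn; have -> : u i ^+ 8 = (u i ^+ 4) ^+ 2 by ring.
    have -> : U^-1 ^+ 8 = (U^-1 ^+ 4) ^+ 2 by rewrite -exprM.
    by move: (u i ^+ 4) (U^-1 ^+ 4) => a b; have := sqr_ge0 (a - b) => ?; nra.
  by rewrite /L; lra.
have LE : (\esum_(i in [set: I]) (p i * L i)%:E <= E)%E.
  pose M i := p i * (4 + 2 * u i ^+ 8 + D i ^+ 2 / 2).
  have M0 i : 0 <= M i by rewrite mulr_ge0// addr_ge0// addr_ge0 ?ler0n// mulr_ge0 ?ler0n.
  rewrite (eq_esum (b := fun i => (M i)%:E + (2 * U^-1 ^+ 8 * p i)%:E)%E); last first.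
    by move=> i _; rewrite -EFinD; congr EFin; rewrite /M /L; ring.
  have UN0 : 0 <= 2 * U^-1 ^+ 8 by rewrite mulr_ge0 ?ler0n// exprn_ge0// invr_ge0 ltW.
  rewrite esumD; [|by move=> i _; rewrite lee_fin|by move=> i _; rewrite lee_fin mulr_ge0].
  rewrite (@esum_EFinZl _ p)// p1 mule1.
  have -> : E = (\esum_(i in [set: I]) (M i)%:E +
      2%:E * \esum_(i in [set: I]) (p i * (u i)^-1 ^+ 8)%:E)%E.
    rewrite -esum_EFinZl ?ler0n//; last by move=> i; rewrite mulr_ge0.
    rewrite -esumD; [|by move=> i _; rewrite lee_fin|by move=> i _; rewrite lee_fin mulr_ge0 ?ler0n// mulr_ge0].
    by apply: eq_esum => i _; rewrite -EFinD; congr EFin; rewrite /M /cost -/(D i); ring.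
  by rewrite leeD2l// EFinM lee_wpmul2l// lee_fin ler0n.
pose x j i := `|1 - y i| * `|s i j - c j|.
have x0 j i : 0 <= x j i by rewrite mulr_ge0.
have x2 j i : x j i ^+ 2 = (1 - y i) ^+ 2 * (s i j - c j) ^+ 2.
  by rewrite exprMn !real_normK ?num_real.
have sumx i : \sum_(j < d) g j * x j i ^+ 2 = (1 - y i) ^+ 2 * D i.
  by rewrite mulr_sumr; apply: eq_bigr => j _; rewrite x2; ring.
have xL j i : g j * x j i ^+ 2 <= L i.
  apply: (le_trans _ (yL i)); rewrite -sumx (bigD1 j)//= lerDl.
  by apply: sumr_ge0 => k _; rewrite mulr_ge0 ?sqr_ge0// ltW.
have xoo j : (\esum_(i in [set: I]) (p i * x j i ^+ 2)%:E < +oo)%E.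
  rewrite ltey_eq; apply/orP; left.
  have px0 i : 0 <= p i * x j i ^+ 2 by rewrite mulr_ge0 ?sqr_ge0.
  apply: (@fin_num_le _ _ ((g j)^-1%:E * E)%E).
  - by apply: esum_ge0 => i _; rewrite lee_fin.
  - rewrite -[leLHS]mul1e -(@mulVf _ (g j)) ?gt_eqF// EFinM -muleA.
    apply: lee_wpmul2l; first by rewrite lee_fin invr_ge0 ltW.
    rewrite -esum_EFinZl ?(ltW (g0 j))//; apply: le_trans LE.
    by apply: le_esum => i _; rewrite lee_fin mulrCA ler_wpM2l.
  - by rewrite lte_mul_pinfty ?lee_fin ?invr_ge0 ?ltW.
pose q i := p i * u i / U.
have q0 i : 0 <= q i by rewrite divr_ge0// ltW.
have q1 : (\esum_(i in [set: I]) (q i)%:E = 1)%E.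
  rewrite (eq_esum (b := fun i => (U^-1 * (p i * u i))%:E)); last first.
    by move=> i _; rewrite mulrC.
  by rewrite esum_EFinZl// ?invr_ge0 ?ltW// UE -EFinM mulVf.
have V j : exists v : R, signed_esum (fun i => (p i - q i) * s i j) = v%:E /\
    ((v ^+ 2)%:E <= \esum_(i in [set: I]) (p i * x j i ^+ 2)%:E)%E.
  have [W WE W2] := esum_sqr_le p0' (x0 j) p1 (xoo j).
  have absE : (\esum_(i in [set: I]) (`|(p i - q i) * (s i j - c j)|)%:E = W%:E)%E.
    rewrite -WE; apply: eq_esum => i _; congr EFin.
    have -> : p i - q i = p i * (1 - y i) by rewrite /q /y; ring.
    by rewrite !normrM (ger0_norm (p0' i)) mulrA.
  have [|v vE] := @signed_esum_center _ _ p q (s ^~ j) (c j) p0' q0 p1 q1.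
    by rewrite absE ltry.
  rewrite absE lee_fin => vW; exists v; split => //; apply: le_trans W2.
  by rewrite lee_fin -(real_normK (num_real v)) lerXn2r ?nnegrE ?(le_trans _ vW).
exists U; split => //.
have [v vE] := choice V.
exists v => [j|]; first by have [] := vE j.
apply: le_trans LE; apply: (@le_trans _ _
    (\sum_(j < d) \esum_(i in [set: I]) (g j * (p i * x j i ^+ 2))%:E)%E).
  rewrite -sumEFin; apply: lee_sum => j _.
  rewrite esum_EFinZl ?(ltW (g0 j))//; last by move=> i; rewrite mulr_ge0 ?sqr_ge0.
  by rewrite EFinM lee_wpmul2l ?lee_fin ?(ltW (g0 j))//; have [] := vE j.
rewrite -esum_sum; last first.
  by move=> i j _ _; rewrite lee_fin mulr_ge0 ?mulr_ge0 ?sqr_ge0// ltW.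
apply: le_esum => i _; rewrite sumEFin lee_fin.
rewrite (eq_bigr (fun j => p i * (g j * x j i ^+ 2))); last by move=> j _; ring.
by rewrite -mulr_sumr sumx ler_wpM2l.
Qed.

(** Multiplying the reweighting bound by the density itself clears every
    denominator; the right-hand side is infinite wherever a mixture density is,
    so that no exceptional set arises. *)
Lemma mixture_reweighting_bound (w f w' f' : I -> R) d (gamma : nat -> R)
    (c : 'I_d -> R) (s : I -> 'I_d -> R) (l : I)
    (g := fun j : 'I_d => gamma j)
    (rho := (\esum_(i in [set: I]) (w i * f i)%:E)%E)
    (rho' := (\esum_(i in [set: I]) (w' i * f' i)%:E)%E) :
  (forall i, 0 < w i) -> (forall i, 0 < f i) ->
  (forall i, 0 < w' i) -> (forall i, 0 < f' i) -> (forall j, 0 < gamma j) ->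
  (weighted_norm2 gamma (fun j => signed_esum (fun i =>
     (w i * f i / fine rho - w' i * f' i / fine rho') * s i j)%R) * rho <=
   \esum_(i in [set: I]) (w i * f i *
      cost (w' i * f' i / (w i * f i)) (sq_dist g c (s i)))%:E)%E.
Proof.
move=> w0 f0 w'0 f'0 gamma0; pose u i := w' i * f' i / (w i * f i).
have wf0 i : 0 < w i * f i by rewrite mulr_gt0.
have wf'0 i : 0 < w' i * f' i by rewrite mulr_gt0.
have u0 i : 0 < u i by rewrite divr_gt0.
have g0 j : 0 < g j by exact: gamma0.
have k0 i : 0 <= cost (u i) (sq_dist g c (s i)) by rewrite cost_ge0// ltW.
have k1 i : 1 <= cost (u i) (sq_dist g c (s i)).
  have e1 : 0 <= u i ^+ 8 by rewrite exprn_ge0// ltW.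
  have e2 : 0 <= (u i)^-1 ^+ 8 by rewrite exprn_ge0// invr_ge0 ltW.
  have e3 : 0 <= sq_dist g c (s i) ^+ 2 / 2 by rewrite divr_ge0 ?sqr_ge0 ?ler0n.
  by rewrite /cost; lra.
set G := (X in (_ <= X)%E).
have [Goo|] := ltP G +oo%E; last by rewrite leye_eq => /eqP ->; exact: leey.
have rhof : rho \is a fin_num.
  apply: fin_num_le Goo.
    by apply: esum_ge0 => i _; rewrite lee_fin ltW.
  apply: le_esum => i _; rewrite lee_fin -{1}(mulr1 (w i * f i)).
  exact: (ler_wpM2l (ltW (wf0 i)) (k1 i)).
have rhoE : rho = (fine rho)%:E by rewrite fineK.
move: rhoE; set r := fine rho => rhoE.
have r0 : 0 < r.
  apply: (@lt_le_trans _ _ (w l * f l)) => //; rewrite -lee_fin -rhoE.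
  apply: (@esum_ge_term _ _ (fun i => (w i * f i)%:E)) => i.
  by rewrite lee_fin ltW.
have rn0 : r != 0 by rewrite gt_eqF.
have rV0 : 0 <= r^-1 by rewrite invr_ge0 ltW.
pose p i := w i * f i / r.
have p0 i : 0 < p i by rewrite divr_gt0.
have p1 : (\esum_(i in [set: I]) (p i)%:E = 1)%E.
  rewrite (eq_esum (b := fun i => (r^-1 * (w i * f i))%:E)); last first.
    by move=> i _; rewrite mulrC.
  rewrite esum_EFinZl//; last by move=> i; exact: ltW.
  by rewrite -/rho rhoE -EFinM mulVf.
have pE : (\esum_(i in [set: I]) (p i * cost (u i) (sq_dist g c (s i)))%:E
    = r^-1%:E * G)%E.
  rewrite -esum_EFinZl//; last by move=> i; exact: (mulr_ge0 (ltW (wf0 i)) (k0 i)).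
  by apply: eq_esum => i _; rewrite /p mulrA [r^-1 * _]mulrC.
have Eoo : (\esum_(i in [set: I])
    (p i * cost (u i) (sq_dist g c (s i)))%:E < +oo)%E.
  by rewrite pE lte_mul_pinfty ?lee_fin.
have [U [U0 UE [v vE vG]]] := reweighting_bound l p0 u0 g0 p1 Eoo.
have rho'E : rho' = (r * U)%:E.
  rewrite EFinM -UE (eq_esum (b := fun i => (r^-1 * (w' i * f' i))%:E)); last first.
    by move=> i _; congr EFin; rewrite /p /u; field; rewrite rn0 !gt_eqF.
  rewrite esum_EFinZl//; last by move=> i; exact: ltW.
  by rewrite muleA -EFinM divff// mul1e.
rewrite rho'E /=; rewrite pE in vG.
rewrite (_ : weighted_norm2 _ _ = (\sum_(j < d) g j * v j ^+ 2)%:E).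
  rewrite rhoE muleC; have : (0 <= r%:E)%E by rewrite lee_fin ltW.
  by move=> /lee_wpmul2l/(_ _ _ vG)/le_trans; apply; rewrite muleA -EFinM divff// mul1e.
rewrite /weighted_norm2 -sumEFin; apply: eq_bigr => j _.
rewrite (_ : signed_esum _ = (v j)%:E).
  by rewrite -EFinM -EFin_expe exprMn sqr_sqrtr// ltW.
rewrite -vE; congr signed_esum; apply/funext => i; congr ((_ - _) * _).
by rewrite /p /u; field; rewrite rn0 !gt_eqF.
Qed.

End pointwise.

(** * Averages and per-mode constants *)

Section averaging.
Context {R : realType} {I : countType}.
Local Open Scope ereal_scope.

Lemma exchange_esum (a : I -> I -> \bar R) : (forall i l, 0 <= a i l) ->
  \esum_(i in [set: I]) \esum_(l in [set: I]) a i l =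
  \esum_(l in [set: I]) \esum_(i in [set: I]) a i l.
Proof.
move=> a0; rewrite !esum_esum//.
rewrite (@reindex_esum R _ _ ([set: I] `*`` (fun=> [set: I]))
  ([set: I] `*`` (fun=> [set: I])) (fun k => (k.2, k.1))
  (fun k => a k.1 k.2))//.
split => [[x y] []//|[x y] [x' y'] _ _ [-> ->]//|[x y] _].
by exists (y, x).
Qed.

(** If [X] is infinite, every [F i] is, and some weight must be present. *)
Lemma le_weighted_average (w : I -> R) (X : \bar R) (F : I -> \bar R) :
  (forall i, 0 < w i)%R -> \esum_(i in [set: I]) (w i)%:E = 1 ->
  0 <= X -> (forall i, X <= F i) ->
  X <= \esum_(i in [set: I]) ((w i)%:E * F i).
Proof.
move=> w0 w1 X0 XF.
have wF i : (w i)%:E * X <= (w i)%:E * F i.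
  by apply: lee_wpmul2l => //; rewrite lee_fin ltW.
apply: (@le_trans _ _ (\esum_(i in [set: I]) ((w i)%:E * X))); last first.
  by apply: le_esum => i _.
case: X X0 {XF wF} => [x|_|//].
  rewrite lee_fin => x0; under eq_esum do rewrite muleC.
  rewrite ge0_esumZl ?w1 ?mule1// => i.
  by rewrite lee_fin ltW.
have [[i _]|noI] := pselect (exists i : I, True).
  apply: le_trans (@esum_ge_term _ _ (fun i => (w i)%:E * +oo) i _).
    by rewrite gt0_muley ?lte_fin.
  by move=> k; rewrite mule_ge0// lee_fin ltW.
move: w1; rewrite esum1; last by move=> i; case: noI; exists i.
by move=> /eqP; rewrite eq_sym onee_eq0.
Qed.

Lemma fine_upper_bound (S : \bar R) : S < +oo ->
  exists b : R, forall x : R, x%:E <= S -> (x <= b)%R.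
Proof.
case: S => [r|//|] _; first by exists r => x; rewrite lee_fin.
by exists 0%R => x; rewrite leeNy_eq.
Qed.

Lemma fine_lower_bound (S : \bar R) : 0 < S ->
  exists2 b : R, (0 < b)%R & forall x : R, S <= x%:E -> (b <= x)%R.
Proof.
case: S => [r|_|//]; first by rewrite lte_fin => r0; exists r.
by exists 1%R => // x; rewrite leye_eq.
Qed.

End averaging.

Section mode_bounds.
Context {R : realType}.

(** A constant that depends only on the mode, for the finitely many modes where
    the perturbation need not be small. *)
Lemma tilt_log_mass_low (c C M b b' v v' : R) (s : R) : 0 < c ->
  c <= v <= C -> c <= v' <= C -> `|b' - b| <= M -> -8 <= s <= 8 ->
  c <= tilt_den s v v' ->
  tilt_log_mass s b b' v v' <= 45 / (c / C) * ((C / c) ^+ 2 + M ^+ 2 / c).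
Proof.
move=> c0 /andP[cv vC] /andP[cv' v'C] bM s8 cD.
have v0 : 0 < v by exact: lt_le_trans cv.
have v'0 : 0 < v' by exact: lt_le_trans cv'.
have C0 : 0 < C by exact: lt_le_trans vC.
have cC0 : 0 < c / C by rewrite divr_gt0.
have vCc (x : R) : c <= x -> c / C <= x / v.
  by move=> cx; rewrite ler_pM ?invr_ge0 ?lef_pV2 ?posrE// ltW.
apply: (le_trans (tilt_log_mass_le b b' v0 v'0 cC0 (vCc _ cv') (vCc _ cD) s8)).
apply: ler_wpM2l; first exact: (divr_ge0 (ler0n _ _) (ltW cC0)).
have Vc : v^-1 <= c^-1 by rewrite lef_pV2 ?posrE.
apply: lerD.
  have ratio : `|(v' - v) / v| <= C / c.
    rewrite normrM (gtr0_norm (x := v^-1)) ?invr_gt0//.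
    by rewrite ler_pM ?normr_ge0 ?invr_ge0 ?(ltW v0)// ler_norml; lra.
  rewrite -real_normK ?num_real// lerXn2r// nnegrE ?normr_ge0//.
  exact: le_trans ratio.
rewrite ler_pM ?sqr_ge0 ?invr_ge0 ?(ltW v0)//.
rewrite -real_normK ?num_real// lerXn2r ?nnegrE//.
exact: le_trans bM.
Qed.

(** The factor [9] is the largest value of [|1 - s|], attained at [s = -8]: this
    is why relative variance changes have to stay below [1 / 9]. *)
Lemma tilt_den_tail (r v v' s : R) : 0 <= r -> 0 < v -> `|v' - v| <= r * v ->
  -8 <= s <= 8 -> 1 - 9 * r <= tilt_den s v v' / v /\ 1 - 9 * r <= v' / v.
Proof.
move=> r0 v0; rewrite ler_norml => /andP[h1 h2] s8.
rewrite !ler_pdivlMr// /tilt_den.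
have rv : 0 <= r * v by rewrite mulr_ge0// ltW.
split; last by lra.
have [s1|s1] := orP (le_total 0 (1 - s)); nra.
Qed.

End mode_bounds.

(** * Expectation bound at a fixed time and dimension *)

Section fixed_time.
Context {R : realType} {I : countType}.

(** The likelihood-ratio factor of the cost integrates to the mass of two
    tilted Gaussians, the distance factor to a Gaussian fourth moment. *)
Lemma upper_integral_cost d (a a' v v' B : nat -> R) (g A mu : 'I_d -> R)
    (bl bu k mass : R) :
  (forall j, 0 < v j) -> (forall j, 0 < v' j) ->
  (forall j, 0 <= g j) -> 0 < bl -> bl <= k <= bu ->
  (forall s : R, s = 8 \/ s = -8 -> forall j, 0 < tilt_den s (v j) (v' j) /\
     tilt_log_mass s (a j) (a' j) (v j) (v' j) <= B j) ->
  \sum_(j < d) B j <= mass ->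
  upper_integral_le (fun x : 'cV[R]_d => normal_prod a v x *
     cost (k * (normal_prod a' v' x / normal_prod a v x))
       (\sum_(j < d) g j * (A j * (x j 0 - a j) + mu j) ^+ 2))
   (4 + 2 * (bu ^+ 8 + bl^-1 ^+ 8) * expR mass
    + 512 * (\sum_(j < d) g j * (A j ^+ 2 * v j + mu j ^+ 2)) ^+ 2).
Proof.
move=> v0 v'0 g0 bl0 /andP[blk kbu] tilt Bmass.
have k0 : 0 < k by exact: lt_le_trans blk.
have bu0 : 0 < bu by exact: lt_le_trans kbu.
have tiltI s : s = 8 \/ s = -8 -> upper_integral_le (fun x : 'cV[R]_d =>
    normal_prod a v x * expR (s * ln (normal_prod a' v' x / normal_prod a v x)))
    (expR mass).
  move=> s8; have U : forall j, _ := tilt _ s8.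
  apply: upper_integral_le_mono (upper_integral_tilt v0 v'0
    (fun j => (U j).1) (fun j => (U j).2)) => [x|]; first exact: lexx.
  by rewrite ler_expR.
have k8 : 0 <= 2 * k ^+ 8 by rewrite mulr_ge0 ?ler0n// exprn_ge0// ltW.
have k8' : 0 <= 2 * k^-1 ^+ 8 by rewrite mulr_ge0 ?ler0n// exprn_ge0// invr_ge0 ltW.
have U1 := upper_integral_leZ (ler0n R 4) (upper_integral_normal_prod (d := d) a v).
have U2 := upper_integral_leZ k8 (tiltI 8 (or_introl erefl)).
have U3 := upper_integral_leZ k8' (tiltI (-8) (or_intror erefl)).
have h2 : 0 <= 2^-1 :> R by rewrite invr_ge0 ler0n.
have U4 := upper_integral_leZ h2 (upper_integral_sqr_sum a A mu v0 g0).
apply: upper_integral_le_mono (upper_integral_leD (upper_integral_leD U1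
  (upper_integral_leD U2 U3)) U4) => [x|]; last first.
  have e0 := expR_ge0 mass.
  have q1 : k ^+ 8 * expR mass <= bu ^+ 8 * expR mass.
    by rewrite ler_wpM2r// lerXn2r// nnegrE ltW.
  have q2 : k^-1 ^+ 8 * expR mass <= bl^-1 ^+ 8 * expR mass.
    by rewrite ler_wpM2r// lerXn2r ?nnegrE ?invr_ge0 ?(ltW k0) ?(ltW bl0)// lef_pV2.
  by move: (_ ^+ 2) => Q; lra.
set N := normal_prod a v x; set r := _ / N.
have N0 : 0 < N by exact: normal_prod_gt0.
have r0 : 0 < r by rewrite divr_gt0// normal_prod_gt0.
have -> : expR (8 * ln r) = r ^+ 8 by rewrite expRM_natl lnK.
have -> : expR (- 8 * ln r) = r^-1 ^+ 8.
  by rewrite mulNr -mulrN -lnV// expRM_natl lnK// posrE invr_gt0.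
rewrite /cost; set Q := \sum_(j < d) _; clearbody Q r N.
rewrite le_eqVlt; apply/orP; left; apply/eqP; field.
by rewrite !gt_eqF.
Qed.

Lemma mixture_expectation_bound d (T t : R) (lambda gamma : nat -> R)
    (w w' : I -> R) (m m' s s' : I -> nat -> R) (B : I -> nat -> R)
    (bl bu mass : R)
    (v := fun i => modevar T lambda s i t) (v' := fun i => modevar T lambda s' i t) :
  (forall i, 0 < w i) -> (forall i, 0 < w' i) ->
  (\esum_(i in [set: I]) (w i)%:E = 1)%E ->
  (forall j, 0 < gamma j) ->
  (forall i j, 0 < v i j) -> (forall i j, 0 < v' i j) ->
  0 < bl -> (forall i, bl <= w' i / w i <= bu) ->
  (forall (e : R), e = 8 \/ e = -8 -> forall i j,
     0 < tilt_den e (v i j) (v' i j) /\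
     tilt_log_mass e (m i j) (m' i j) (v i j) (v' i j) <= B i j) ->
  (forall i, \sum_(j < d) B i j <= mass) ->
  (mixture_expectation T lambda w m s t (fun x : 'cV[R]_d =>
     weighted_norm2 gamma (I2 T lambda w m s w' m' s' t x)) <=
   (4 + 2 * (bu ^+ 8 + bl^-1 ^+ 8) * expR mass)%:E +
   512%:E * \esum_(i in [set: I]) \esum_(l in [set: I]) (w i * w l *
     (\sum_(j < d) gamma j *
        (((v' l j)^-1 - (v' i j)^-1) ^+ 2 * v i j +
         ((m i j - m' l j) / v' l j - (m i j - m' i j) / v' i j) ^+ 2)) ^+ 2)%:E)%E.
Proof.
move=> w0 w'0 w1 gamma0 v0 v'0 bl0 beta tilt Bmass.
pose g (j : 'I_d) := gamma j.
pose A i l (j : 'I_d) := (v' l j)^-1 - (v' i j)^-1.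
pose mu i l (j : 'I_d) := (m i j - m' l j) / v' l j - (m i j - m' i j) / v' i j.
pose Q i l := \sum_(j < d) g j * (A i l j ^+ 2 * v i j + mu i l j ^+ 2).
set C := 4 + _; pose f i := normal_prod (m i) (v i) (d := d).
pose f' i := normal_prod (m' i) (v' i) (d := d).
pose S i (x : 'cV[R]_d) (j : 'I_d) := score T lambda m' s' i t x j 0.
pose H i l x := f i x * cost (w' i / w i * (f' i x / f i x))
  (\sum_(j < d) g j * (A i l j * (x j 0 - m i j) + mu i l j) ^+ 2).
have g0 j : 0 <= g j by rewrite ltW// /g.
have f0 i x : 0 < f i x by exact: normal_prod_gt0.
have f'0 i x : 0 < f' i x by exact: normal_prod_gt0.
have UH (il : I * I) : exists h : d.-tuple R -> R,
    [/\ measurable_fun [set: d.-tuple R] h, forall x, 0 <= h x,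
      (\int[lebesgue_tuple R d]_x (h x)%:E <= (C + 512 * Q il.1 il.2 ^+ 2)%:E)%E &
      forall x : d.-tuple R, H il.1 il.2 (\col_j tnth x j) <= h x].
  apply: (upper_integral_cost (B := B il.1)) => //.
  by move=> e e8 j; exact: tilt.
have {UH}[h0 hP] := choice UH; pose h i l := h0 (i, l).
have mh i l : measurable_fun [set: d.-tuple R] (h i l) by have [] := hP (i, l).
have h_ge0 i l x : 0 <= h i l x.
  by have [_ + _ _] := hP (i, l); exact.
have hC i l : (\int[lebesgue_tuple R d]_x (h i l x)%:E <=
    (C + 512 * Q i l ^+ 2)%:E)%E by have [] := hP (i, l).
have Hh i l (x : d.-tuple R) : H i l (\col_j tnth x j) <= h i l x.
  by have [_ _ _] := hP (i, l); exact.
have wh0 i l x : (0 <= (w i)%:E * (h i l x)%:E)%E.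
  by rewrite mule_ge0 ?lee_fin// ltW.
have wwh0 i l x : (0 <= (w l)%:E * \esum_(i in [set: I]) ((w i)%:E * (h i l x)%:E))%E.
  by apply: mule_ge0; [rewrite lee_fin ltW|apply: esum_ge0].
have rhoE (y : 'cV[R]_d) (u : I -> R) (n z : I -> nat -> R) :
    (forall i j, 0 < modevar T lambda z i t j) ->
    mixture_pdf T lambda u n z t y =
    (\esum_(i in [set: I]) (u i * normal_prod (n i) (modevar T lambda z i t) y)%:E)%E.
  by move=> z0; apply: eq_esum => i _; rewrite comp_pdfE.
have I2E (y : 'cV[R]_d) : I2 T lambda w m s w' m' s' t y = (fun j => signed_esum (fun i =>
    (w i * f i y / fine (\esum_(i in [set: I]) (w i * f i y)%:E)%E -
     w' i * f' i y / fine (\esum_(i in [set: I]) (w' i * f' i y)%:E)%E) * S i y j)).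
  apply/funext => j; congr signed_esum; apply/funext => i.
  by rewrite /posterior !rhoE// !comp_pdfE//; [exact: v'0|exact: v0].
have norm_ge0 (V : 'I_d -> \bar R) : (0 <= weighted_norm2 gamma V)%E.
  by apply: sume_ge0 => j _; exact: sqre_ge0.
have rho_ge0 (y : 'cV[R]_d) : (0 <= mixture_pdf T lambda w m s t y)%E.
  rewrite rhoE//; apply: esum_ge0 => i _.
  by rewrite lee_fin (mulr_ge0 (ltW (w0 i)) (ltW (f0 i y))).
(* The pointwise bound holds for every anchor [l]; average it with weights
   [w l]. *)
have dom (x : d.-tuple R) (y := \col_j tnth x j) :
  (weighted_norm2 gamma (I2 T lambda w m s w' m' s' t y) *
    mixture_pdf T lambda w m s t y <=
   \esum_(l in [set: I]) ((w l)%:E *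
     \esum_(i in [set: I]) ((w i)%:E * (h i l x)%:E)))%E.
  apply: le_weighted_average => //; first exact: mule_ge0.
  move=> l; rewrite I2E rhoE//.
  apply: (le_trans (@mixture_reweighting_bound R I w (f ^~ y) w' (f' ^~ y) d gamma
    (S l y) (fun i => S i y) l w0 (f0 ^~ y) w'0 (f'0 ^~ y) gamma0)).
  apply: le_esum => i _; rewrite -EFinM lee_fin -mulrA; apply: ler_wpM2l.
    exact: ltW.
  apply: le_trans (Hh i l x); rewrite /H -/y le_eqVlt; apply/orP; left; apply/eqP.
  congr (_ * cost _ _); first by rewrite invfM mulrACA.
  apply: eq_bigr => j _; congr (_ * _ ^+ 2).
  rewrite /S !scoreE; [|exact: v'0..].
  rewrite -/(v' l j) -/(v' i j) /A /mu.
  by field; rewrite !gt_eqF.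
apply: (le_trans (ge0_le_upper_integral (lebesgue_tuple R d) _ dom)).
  by move=> x; exact: mule_ge0.
have mwh i l : measurable_fun [set: d.-tuple R] (fun x => (w i)%:E * (h i l x)%:E)%E.
  by apply: measurable_funeM; exact/measurable_EFinP.
have msum l : measurable_fun [set: d.-tuple R]
    (fun x => \esum_(i in [set: I]) ((w i)%:E * (h i l x)%:E))%E.
  by apply: ge0_measurable_esum => i; [exact: mwh|move=> x; exact: wh0].
rewrite ge0_integral_esum; last 2 first.
- by move=> l; apply: measurable_funeM; exact: msum.
- by move=> l x; exact: wwh0.
apply: (@le_trans _ _ (\esum_(l in [set: I]) ((w l)%:E *
    \esum_(i in [set: I]) (C%:E * (w i)%:E + 512%:E * (w i * Q i l ^+ 2)%:E)))%E).
  apply: le_esum => l _.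
  rewrite ge0_integralZl_EFin//; last 3 first.
  - by move=> x _; apply: esum_ge0.
  - exact: msum.
  - exact: ltW.
  apply: lee_wpmul2l; first by rewrite lee_fin ltW.
  rewrite ge0_integral_esum; [|by move=> i; exact: mwh|by move=> i x; exact: wh0].
  apply: le_esum => i _.
  rewrite ge0_integralZl_EFin//; last 3 first.
  - by move=> x _; rewrite lee_fin; exact: h_ge0.
  - by apply/measurable_EFinP; exact: mh.
  - exact: ltW.
  apply: (@le_trans _ _ ((w i)%:E * (C + 512 * Q i l ^+ 2)%:E)%E).
    by apply: lee_wpmul2l; rewrite ?lee_fin ?(ltW (w0 i)).
  by rewrite -!EFinM -EFinD lee_fin le_eqVlt; apply/orP; left; apply/eqP; ring.
have QQ0 i l : (0 <= (w i * w l * Q i l ^+ 2)%:E)%E.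
  by rewrite lee_fin mulr_ge0 ?sqr_ge0// mulr_ge0// ltW.
rewrite (exchange_esum QQ0) le_eqVlt; apply/orP; left; apply/eqP.
have C0 : 0 <= C.
  rewrite addr_ge0 ?ler0n// mulr_ge0 ?expR_ge0// mulr_ge0 ?ler0n//.
  by rewrite addr_ge0// exprn_even_ge0.
have wQ0 i l : (0 <= (w i * Q i l ^+ 2)%:E)%E by rewrite lee_fin mulr_ge0 ?sqr_ge0// ltW.
have wE0 i : (0 <= (w i)%:E)%E by rewrite lee_fin ltW.
have Cw0 i : (0 <= C%:E * (w i)%:E)%E by apply: mule_ge0; rewrite ?lee_fin// ltW.
have k512 : 0 <= 512 :> R by exact: ler0n.
transitivity (\esum_(l in [set: I]) (C%:E * (w l)%:E +
    512%:E * \esum_(i in [set: I]) (w i * w l * Q i l ^+ 2)%:E))%E.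
  apply: eq_esum => l _; rewrite esumD; last 2 first.
  - by move=> i _; exact: Cw0.
  - by move=> i _; apply: mule_ge0; [rewrite lee_fin|exact: wQ0].
  rewrite !ge0_esumZl// w1 mule1.
  have -> : (\esum_(i in [set: I]) (w i * w l * Q i l ^+ 2)%:E =
      (w l)%:E * \esum_(i in [set: I]) (w i * Q i l ^+ 2)%:E)%E.
    rewrite -ge0_esumZl ?(ltW (w0 l))//; apply: eq_esum => i _.
    by rewrite -EFinM; congr EFin; ring.
  rewrite ge0_muleDr; [|by rewrite lee_fin|]; last first.
    by apply: mule_ge0; [rewrite lee_fin|apply: esum_ge0 => i _; exact: wQ0].
  by rewrite [((w l)%:E * C%:E)%E]muleC muleCA.
rewrite esumD; last 2 first.
- by move=> i _; exact: Cw0.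
- move=> l _; apply: mule_ge0; rewrite ?lee_fin//.
  by apply: esum_ge0 => i _; exact: QQ0.
rewrite !ge0_esumZl ?w1 ?mule1// => l.
by apply: esum_ge0 => i _; exact: QQ0.
Qed.

End fixed_time.

(** * Uniform bound *)

Theorem propositionB7 (R : realType) (I : countType) (T : R)
    (w dw : I -> R) (m dm sigma dsigma : I -> nat -> R)
    (lambda gamma : nat -> R) (J : nat) (rho_tail : R)
    (w' := fun i => w i + dw i)
    (m' := fun i j => m i j + dm i j)
    (sigma' := fun i j => sigma i j + dsigma i j)
    (beta := fun i => w' i / w i)
    (Sig := modevar T lambda sigma)
    (Sig' := modevar T lambda sigma') :
  0 < T ->
  (forall i, 0 < w i) ->
  (\esum_(i in [set: I]) (w i)%:E = 1)%E ->
  (forall i j, 0 < sigma i j) ->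
  (forall i, (\sum_(0 <= j <oo) ((m i j) ^+ 2)%:E < +oo)%E) ->
  (forall i, (\sum_(0 <= j <oo) (sigma i j)%:E < +oo)%E) ->
  (forall j, 0 < lambda j) ->
  (\sum_(0 <= j <oo) (lambda j)%:E < +oo)%E ->
  (forall j, 0 < gamma j) ->
  (forall i j, 0 < sigma' i j) ->
  (forall i, 0 < w' i) ->
  (\esum_(i in [set: I]) (w' i)%:E = 1)%E ->
  (* uniformly controlled weight perturbation *)
  (0 < ereal_inf [set (beta i)%:E | i in [set: I]])%E ->
  (\esup_(i in [set: I]) (beta i)%:E < +oo)%E ->
  0 < rho_tail < 1 / 9 ->
  (* low modes *)
  (forall j, (j < J)%N -> exists c C M : R, 0 < c /\
     forall i t, 0 <= t <= T ->
       [/\ c <= Sig i t j <= C,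
           c <= Sig' i t j <= C,
           `|dm i j| <= M &
           forall s : int, s \in [:: -8; 0; 1; 2; 3; 4; 5; 6; 7; 8] ->
             c <= Sig i t j + (1 - s%:~R) * dsigma i j]) ->
  (* tail modes *)
  (forall i j t, (J <= j)%N -> 0 <= t <= T ->
     `|dsigma i j| <= rho_tail * Sig i t j /\
     `|dm i j| <= rho_tail * Num.sqrt (Sig i t j)) ->
  (\esup_(i in [set: I]) \esup_(t in `[0%R, T]) \esup_(d in [set d | (1 <= d)%N])
     (\sum_(J <= j < d)
        ((dsigma i j) ^+ 2 / (Sig i t j) ^+ 2
         + (dm i j) ^+ 2 / Sig i t j))%:E < +oo)%E ->
  (* fourth-moment condition on the score differences *)
  (\esup_(t in `[0%R, T]) \esup_(d in [set d | (1 <= d)%N])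
     \esum_(i in [set: I]) \esum_(l in [set: I])
       (w i * w l *
        (\sum_(j < d) gamma j *
           (((sigma l j - sigma i j) + (dsigma l j - dsigma i j)) ^+ 2
              * Sig i t j / ((Sig' i t j) ^+ 2 * (Sig' l t j) ^+ 2)
            + (dm i j / Sig' i t j
               - (m l j - m i j + dm l j) / Sig' l t j) ^+ 2)) ^+ 2)%:E
   < +oo)%E ->
  (\esup_(t in `[0%R, T]) \esup_(d in [set d | (1 <= d)%N])
     mixture_expectation T lambda w m sigma t
       (fun x : 'cV[R]_d => weighted_norm2 gamma
          (I2 T lambda w m sigma w' m' sigma' t x))
   < +oo)%E.
Proof.
move=> T0 w0 w1 s0 _ _ lam0 _ gam0 s'0 w'0 _ binf bsup /andP[rho0 rho9] low tail
  tailsum moment.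
have kap t : 0 <= t <= T -> 0 <= kappa T t.
  by move=> /andP[t0 tT]; rewrite /kappa divr_ge0 ?subr_ge0// ltW.
have Sig0 i t j : 0 <= t <= T -> 0 < Sig i t j.
  by move=> tT; rewrite ltr_pwDl// mulr_ge0 ?kap// ltW.
have Sig'0 i t j : 0 <= t <= T -> 0 < Sig' i t j.
  by move=> tT; rewrite ltr_pwDl// mulr_ge0 ?kap// ltW.
have SigB i t j : Sig' i t j - Sig i t j = dsigma i j.
  by rewrite /Sig' /Sig /modevar /sigma'; ring.
have dmE i j : m' i j - m i j = dm i j by rewrite /m'; ring.
have [bl bl0 blP] := fine_lower_bound binf.
have [bu buP] := fine_upper_bound bsup.
have betaP i : bl <= w' i / w i <= bu.
  apply/andP; split; [apply: blP; apply: ereal_inf_lbound|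
    apply: buP; apply: ereal_sup_ubound]; by exists i.
have [M3 M3P] := fine_upper_bound tailsum.
pose e i t j := (dsigma i j) ^+ 2 / (Sig i t j) ^+ 2 + (dm i j) ^+ 2 / Sig i t j.
have tailM i t d : 0 <= t <= T -> (1 <= d)%N -> \sum_(J <= j < d) e i t j <= M3.
  move=> tT d1; apply: M3P.
  apply: (@le_trans _ _ (\esup_(t in `[0%R, T]) \esup_(d in [set d | (1 <= d)%N])
     (\sum_(J <= j < d) e i t j)%:E)%E); last first.
    by apply: ereal_sup_ubound; exists i.
  apply: (@le_trans _ _ (\esup_(d in [set d | (1 <= d)%N])
     (\sum_(J <= j < d) e i t j)%:E)%E); last first.
    by apply: ereal_sup_ubound; exists t => //; rewrite /= in_itv.
  by apply: ereal_sup_ubound; exists d.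
pose ct := 1 - 9 * rho_tail.
have ct0 : 0 < ct by rewrite /ct; lra.
(* A constant for each low mode; a multiple of the summable quantity [e] for
   each tail mode. *)
have modeB j : exists B : R, 0 <= B /\ forall i t (s : R), 0 <= t <= T ->
    s = 8 \/ s = -8 -> 0 < tilt_den s (Sig i t j) (Sig' i t j) /\
    tilt_log_mass s (m i j) (m' i j) (Sig i t j) (Sig' i t j) <=
      if (j < J)%N then B else 45 / ct * e i t j.
  case: ltnP => [jJ|Jj]; last first.
    exists 0; split => // i t s tT s8.
    have s88 : -8 <= s <= 8 by case: s8 => ->; lra.
    have [ds dmm] := tail i j t Jj tT; rewrite -(SigB i t) in ds.
    have [h1 h2] := tilt_den_tail (ltW rho0) (Sig0 i t j tT) ds s88.
    split.
      rewrite -(pmulr_lgt0 _ (_ : 0 < (Sig i t j)^-1)) ?invr_gt0 ?Sig0//.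
      exact: lt_le_trans h1.
    have := tilt_log_mass_le (m i j) (m' i j) (Sig0 i t j tT) (Sig'0 i t j tT)
      ct0 h2 h1 s88.
    by rewrite SigB dmE expr_div_n.
  have [c [C [M [c0 cP]]]] := low j jJ.
  exists `|45 / (c / C) * ((C / c) ^+ 2 + M ^+ 2 / c)|; split => // i t s tT s8.
  have s88 : -8 <= s <= 8 by case: s8 => ->; lra.
  have [cS cS' dmM sP] := cP i t tT.
  have cD : c <= tilt_den s (Sig i t j) (Sig' i t j).
    rewrite /tilt_den SigB; case: s8 => ->.
      exact: (sP 8).
    exact: (sP (-8)).
  split; first exact: lt_le_trans cD.
  apply: le_trans (ler_norm _).
  by apply: tilt_log_mass_low; rewrite ?dmE.
have [B BP] := choice modeB.
(* The logarithmic mass of all modes together is bounded by [mass], uniformly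
   in [i], [t] and [d]. *)
pose F t i j := if (j < J)%N then B j else 45 / ct * e i t j.
have ct45 : 0 <= 45 / ct by exact: (divr_ge0 (ler0n _ _) (ltW ct0)).
have Fsum t i d : 0 <= t <= T -> (1 <= d)%N ->
    \sum_(j < d) F t i j <= \sum_(0 <= j < J) B j + 45 / ct * M3.
  move=> tT d1; rewrite -(big_mkord xpredT (F t i)).
  have tM := tailM i t d tT d1; have [dJ|Jd] := leqP d J.
    rewrite big_geq// in tM; rewrite [X in _ <= X + _](big_cat_nat (leq0n d) dJ)/= -addrA.
    rewrite [leLHS](eq_big_nat _ _ (F2 := B)); last first.
      by move=> j /andP[_ jd]; rewrite /F (leq_trans jd dJ).
    rewrite lerDl; apply: addr_ge0; last exact: mulr_ge0.
    by apply: sumr_ge0 => j _; have [] := BP j.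
  rewrite (big_cat_nat (leq0n J) (ltnW Jd))/=; apply: lerD.
    by rewrite le_eqVlt; apply/orP; left; apply/eqP;
      apply: eq_big_nat => j /andP[_ jJ]; rewrite /F jJ.
  apply: le_trans (ler_wpM2l ct45 tM); rewrite mulr_sumr le_eqVlt.
  apply/orP; left; apply/eqP; apply: eq_big_nat => j /andP[Jj _].
  by rewrite /F ltnNge Jj.
set K := (X in (X < +oo)%E) in moment.
pose mass := \sum_(0 <= j < J) B j + 45 / ct * M3.
apply: (@le_lt_trans _ _ ((4 + 2 * (bu ^+ 8 + bl^-1 ^+ 8) * expR mass)%:E
  + 512%:E * K)%E); last first.
  apply: lte_add_pinfty; first exact: ltry.
  by apply: lte_mul_pinfty moment; rewrite ?lee_fin ?ler0n.
apply: ge_ereal_sup => _ [t tT <-]; rewrite /= in_itv/= in tT.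
apply: ge_ereal_sup => _ [d /= d1 <-].
apply: le_trans (mixture_expectation_bound (B := F t) w0 w'0 w1 gam0
  (fun i j => Sig0 i t j tT) (fun i j => Sig'0 i t j tT) bl0 betaP _ _) _.
- by move=> s s8 i j; have [_ /(_ i t s tT s8)] := BP j.
- by move=> i; exact: Fsum.
rewrite leeD2l//; apply: lee_wpmul2l; first by rewrite lee_fin ler0n.
apply: (@le_trans _ _ (\esup_(d in [set d | (1 <= d)%N])
     \esum_(i in [set: I]) \esum_(l in [set: I])
       (w i * w l *
        (\sum_(j < d) gamma j *
           (((sigma l j - sigma i j) + (dsigma l j - dsigma i j)) ^+ 2
              * Sig i t j / ((Sig' i t j) ^+ 2 * (Sig' l t j) ^+ 2)
            + (dm i j / Sig' i t j
               - (m l j - m i j + dm l j) / Sig' l t j) ^+ 2)) ^+ 2)%:E)%E); last first.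
  by apply: ereal_sup_ubound; exists t => //; rewrite /= in_itv.
apply: ereal_sup_ubound; exists d => //.
apply: eq_esum => i _; apply: eq_esum => l _; congr (_ * _ ^+ 2)%:E.
apply: eq_bigr => j _; congr (_ * _).
have v1 := Sig'0 i t j tT; have v2 := Sig'0 l t j tT.
rewrite (_ : sigma l j - sigma i j + _ = Sig' l t j - Sig' i t j); last first.
  by rewrite /Sig' /modevar /sigma'; ring.
rewrite -/(Sig i t j) -/(Sig' i t j) -/(Sig' l t j) /m'.
move: (Sig' i t j) (Sig' l t j) (Sig i t j) v1 v2 => a b v a0 b0.
by field; rewrite !gt_eqF.
Qed.
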